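(* If $W$ is a Segal space, then the twisted arrow projection $\mathrm{Tw}\,W\to W^{op}\times W$ is a left fibration.
   Context: A space means a simplicial set, and a simplicial space is a functor $X\colon \Delta^{op}\to \mathrm{sSet}$, where $\Delta$ is the simplex category; $X_n$ denotes the space $X([n])$. Write $X_{kl}$ for the set of $l$-simplices of $X_k$. The category of simplicial spaces is enriched in spaces by $\mathrm{Map}(X,Y)_n=\mathrm{Hom}(X\times\Delta[n],Y)$, with $\Delta[n]$ regarded as a constant simplicial space. $F(n)$ is the simplicial space with $F(n)_{kl}=\mathrm{Hom}_\Delta([k],[n])$ for all $l$, and $\partial F(n)_{kl}=\partial\Delta[n]_k$. Thus $\mathrm{Map}(F(n),X)\cong X_n$. $G(n)\subseteq F(n)$ is the sub-simplicial space of all $\varphi\colon[k]\to[n]$ with $\varphi(k)-\varphi(0)\le 1$. A map $Y\to X$ of simplicial spaces is a Reedy fibration if for each $n\ge0$ the map $\mathrm{Map}(F(n),Y)\to\mathrm{Map}(\partial F(n),Y)\times_{\mathrm{Map}(\partial F(n),X)}\mathrm{Map}(F(n),X)$ is a Kan fibration; $W$ is Reedy fibrant if $W\to F(0)$ is a Reedy fibration. A Segal space is a Reedy fibrant simplicial space $W$ such that for all $n\ge2$ the map $W_n\to\mathrm{Map}(G(n),W)\cong W_1\times_{W_0}\cdots\times_{W_0}W_1$ induced by $G(n)\hookrightarrow F(n)$ is a Kan equivalence (weak homotopy equivalence of simplicial sets). A map $p\colon L\to X$ of simplicial spaces is a left fibration if $p$ is a Reedy fibration and for every $n\ge1$ the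 square with horizontal maps $\{0\}^*\colon L_n\to L_0$, $\{0\}^*\colon X_n\to X_0$ and vertical maps $p_n\colon L_n\to X_n$, $p_0\colon L_0\to X_0$ is a homotopy pullback square of spaces, where $\{0\}\colon[0]\to[n]$ is the map with image $0$. Twisted arrow construction: let $Q\colon\Delta\to\Delta$ be the functor $Q([n])=[n]^{op}\star[n]\cong[2n+1]$, $Q(\alpha)=\alpha^{op}\star\alpha$, where $\star$ is the join of posets. The twisted arrow construction $\mathrm{Tw}$ on simplicial spaces is (up to natural isomorphism) the precomposition functor $Q^*$, so $\mathrm{Tw}(W)_n=W_{2n+1}$. $W^{op}$ is the precomposition of $W$ with the automorphism $[n]\mapsto[n]^{op}\cong[n]$ of $\Delta$. The projection $\mathrm{Tw}\,W\to W^{op}\times W$ is induced by the natural inclusions $[n]^{op}\hookrightarrow[n]^{op}\star[n]\hookleftarrow[n]$. *)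

(* Defs.v *)
From mathcomp Require Import all_boot.
From mathcomp Require Import boolp.
From Stdlib Require Import Relation_Operators.

Set Implicit Arguments.
Unset Strict Implicit.
Unset Printing Implicit Defensive.

(* The object [n] is represented by the natural number n; a morphism
   [m] -> [n] is a monotone map between the ordinals with m.+1 and n.+1
   elements. *)
Record dhom (m n : nat) := DHom {
  dfun :> 'I_m.+1 -> 'I_n.+1;
  dmono : forall i j : 'I_m.+1, i <= j -> dfun i <= dfun j }.

Lemma dhomP m n (f g : dhom m n) : (forall i, f i = g i) -> f = g.
Proof.
case: f g => [f fm] [g gm] /= fg; have e : f = g by apply: funext.
by subst g; rewrite (Prop_irrelevance fm gm).
Qed.

Definition did n : dhom n n := @DHom n n (fun i => i) (fun i j ij => ij).

Definition dcomp m n p (g : dhom n p) (f : dhom m n) : dhom m p :=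
  @DHom m p (fun i => g (f i)) (fun i j ij => dmono g (dmono f ij)).

Definition dconst m n (a : 'I_n.+1) : dhom m n :=
  @DHom m n (fun _ => a) (fun _ _ _ => leqnn a).

Record dfunctor := DFunctor {
  dF_ob :> nat -> nat;
  dF_map : forall m n, dhom m n -> dhom (dF_ob m) (dF_ob n);
  dF_id : forall n, dF_map (did n) = did (dF_ob n);
  dF_comp : forall m n p (g : dhom n p) (f : dhom m n),
    dF_map (dcomp g f) = dcomp (dF_map g) (dF_map f) }.

(* f^op : [m]^op -> [n]^op, read through the isomorphism [n]^op = [n]
   given by i |-> n - i. *)
Lemma dop_mono m n (f : dhom m n) (i j : 'I_m.+1) :
  i <= j -> rev_ord (f (rev_ord i)) <= rev_ord (f (rev_ord j)).
Proof. by move=> ij; rewrite leq_sub2l // ltnS dmono //= leq_sub2l. Qed.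

Definition dop m n (f : dhom m n) : dhom m n := DHom (dop_mono f).

Lemma dop_id n : dop (did n) = did n.
Proof. by apply: dhomP => i /=; rewrite rev_ordK. Qed.

Lemma dop_comp m n p (g : dhom n p) (f : dhom m n) :
  dop (dcomp g f) = dcomp (dop g) (dop f).
Proof. by apply: dhomP => i /=; rewrite rev_ordK. Qed.

Definition opD : dfunctor := DFunctor dop_id dop_comp.

(* The join [m] * [n] of posets is [m + n + 1]: its underlying ordinal is
   'I_(m.+1 + n.+1), which is convertible to 'I_(m + n.+1).+1; [lshift] and
   [rshift] are the inclusions of the two factors. *)
Definition djoin_fun m n m' n' (f : dhom m m') (g : dhom n n')
    (i : 'I_(m.+1 + n.+1)) : 'I_(m'.+1 + n'.+1) :=
  match split i with
  | inl a => lshift n'.+1 (f a)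
  | inr b => rshift m'.+1 (g b)
  end.

Lemma djoin_mono m n m' n' (f : dhom m m') (g : dhom n n')
    (i j : 'I_(m + n.+1).+1) :
  i <= j -> djoin_fun f g i <= djoin_fun f g j.
Proof.
rewrite /djoin_fun; case: splitP => a ea; case: splitP => b eb /=; rewrite ea eb.
- exact: dmono.
- by move=> _; rewrite (leq_trans (ltnW (ltn_ord _))) // leq_addr.
- by move=> h; move: (leq_ltn_trans h (ltn_ord b)); rewrite ltnNge leq_addr.
- by rewrite !leq_add2l; apply: dmono.
Qed.

Definition djoin m n m' n' (f : dhom m m') (g : dhom n n') :
    dhom (m + n.+1) (m' + n'.+1) :=
  @DHom (m + n.+1) (m' + n'.+1) (djoin_fun f g) (@djoin_mono m n m' n' f g).

Lemma djoin_id m n : djoin (did m) (did n) = did (m + n.+1).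
Proof.
by apply: dhomP => i /=; rewrite /djoin_fun; case: splitP => a ea; apply: val_inj.
Qed.

Lemma djoin_comp m n m' n' m'' n'' (f' : dhom m' m'') (g' : dhom n' n'')
    (f : dhom m m') (g : dhom n n') :
  djoin (dcomp f' f) (dcomp g' g) = dcomp (djoin f' g') (djoin f g).
Proof.
apply: dhomP => i /=; rewrite /djoin_fun; case: (@split m.+1 n.+1 i) => a.
  by rewrite (unsplitK (inl _ : 'I_m'.+1 + 'I_n'.+1)).
by rewrite (unsplitK (inr _ : 'I_m'.+1 + 'I_n'.+1)).
Qed.

(* Q [n] = [n]^op * [n], that is [2n+1] written as n + n.+1. *)
Definition Qmap m n (f : dhom m n) : dhom (m + m.+1) (n + n.+1) :=
  djoin (dop f) f.

Lemma Qmap_id n : Qmap (did n) = did (n + n.+1).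
Proof. by rewrite /Qmap dop_id djoin_id. Qed.

Lemma Qmap_comp m n p (g : dhom n p) (f : dhom m n) :
  Qmap (dcomp g f) = dcomp (Qmap g) (Qmap f).
Proof. by rewrite /Qmap dop_comp djoin_comp. Qed.

Definition Q : dfunctor := DFunctor Qmap_id Qmap_comp.

Definition Qinl n : dhom n (n + n.+1) :=
  @DHom n (n + n.+1) (fun i => lshift n.+1 i) (fun i j ij => ij).

Lemma Qinr_mono n (i j : 'I_n.+1) :
  i <= j -> rshift n.+1 i <= rshift n.+1 j.
Proof. by rewrite /= leq_add2l. Qed.

Definition Qinr n : dhom n (n + n.+1) :=
  @DHom n (n + n.+1) (fun i => rshift n.+1 i) (@Qinr_mono n).

Lemma Qinl_nat m n (f : dhom m n) :
  dcomp (Qmap f) (Qinl m) = dcomp (Qinl n) (dop f).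
Proof.
apply: dhomP => i /=; rewrite /djoin_fun.
by rewrite (unsplitK (inl i : 'I_m.+1 + 'I_m.+1)).
Qed.

Lemma Qinr_nat m n (f : dhom m n) :
  dcomp (Qmap f) (Qinr m) = dcomp (Qinr n) f.
Proof.
apply: dhomP => i /=; rewrite /djoin_fun.
by rewrite (unsplitK (inr i : 'I_m.+1 + 'I_m.+1)).
Qed.

Record sset := SSet {
  sset_ob :> nat -> Type;
  act : forall m n, dhom m n -> sset_ob n -> sset_ob m;
  act_id : forall n (x : sset_ob n), act (did n) x = x;
  act_comp : forall m n p (g : dhom n p) (f : dhom m n) (x : sset_ob p),
    act (dcomp g f) x = act f (act g x) }.

Record shom (X Y : sset) := SHom {
  shom_fun :> forall n, X n -> Y n;
  shom_nat : forall m n (a : dhom m n) (x : X n),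
    shom_fun (act a x) = act a (shom_fun x) }.

Arguments shom_fun {X Y} _ n x.

Definition scomp (X Y Z : sset) (g : shom Y Z) (f : shom X Y) : shom X Z.
Proof.
by exists (fun n x => g n (f n x)) => m n a x; rewrite !shom_nat.
Defined.

Definition simplex (n : nat) : sset.
Proof.
exists (fun k => dhom k n) (fun _ _ a f => dcomp f a).
- by move=> k f; apply: dhomP.
- by move=> k l p g f x; apply: dhomP.
Defined.

Definition simplex_map m n (a : dhom m n) : shom (simplex m) (simplex n).
Proof.
by exists (fun k (f : simplex m k) => dcomp a f : simplex n k) => k l b f;
  apply: dhomP.
Defined.

Definition to_point (X : sset) : shom X (simplex 0).
Proof.
by exists (fun k _ => dconst k ord0 : simplex 0 k) => k l a x; apply: dhomP.
Defined.

Definition sprod (X Y : sset) : sset.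
Proof.
exists (fun n => (X n * Y n)%type) (fun _ _ a z => (act a z.1, act a z.2)).
- by move=> n [x y]; rewrite !act_id.
- by move=> m n p g f [x y]; rewrite !act_comp.
Defined.

Definition sprod_map (X X' Y Y' : sset) (f : shom X X') (g : shom Y Y') :
  shom (sprod X Y) (sprod X' Y').
Proof.
exists (fun n (z : sprod X Y n) => (f n z.1, g n z.2) : sprod X' Y' n).
by move=> m n a [x y] /=; rewrite !shom_nat.
Defined.

Definition spullback (B C D : sset) (r : shom B D) (b : shom C D) : sset.
Proof.
exists (fun n => {z : B n * C n | r n z.1 = b n z.2})
  (fun m n a z => exist (fun z : B m * C m => r m z.1 = b m z.2)
    (act a (sval z).1, act a (sval z).2)
    (etrans (shom_nat r a _) (etrans (congr1 (act a) (svalP z))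
      (esym (shom_nat b a _))))).
- by move=> n [[x y] e]; apply: eq_exist; rewrite /= !act_id.
- by move=> m n p g f [[x y] e]; apply: eq_exist; rewrite /= !act_comp.
Defined.

Definition spullback_pair (A B C D : sset) (r : shom B D) (b : shom C D)
  (f : shom A B) (g : shom A C) (e : forall n x, r n (f n x) = b n (g n x)) :
  shom A (spullback r b).
Proof.
exists (fun n x => exist (fun z : B n * C n => r n z.1 = b n z.2)
  (f n x, g n x) (e n x) : spullback r b n).
by move=> m n a x; apply: eq_exist; rewrite /= !shom_nat.
Defined.

(* The simplicial subset of Delta[n] cut out by a predicate on simplices that
   is stable under the simplicial operators. *)
Definition stable n (P : forall k, pred (dhom k n)) : Prop :=
  forall k l (a : dhom k l) (f : dhom l n), P l f -> P k (dcomp f a).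

Definition subsimplex n (P : forall k, pred (dhom k n)) (h : stable P) : sset.
Proof.
exists (fun k => {f : dhom k n | P k f})
  (fun k l a f => exist (P k) (dcomp (sval f) a) (h _ _ a _ (svalP f))).
- by move=> k [f e]; apply: eq_exist; apply: dhomP.
- by move=> k l p g a [f e]; apply: eq_exist; apply: dhomP.
Defined.

Definition subsimplex_incl n (P : forall k, pred (dhom k n)) (h : stable P) :
  shom (subsimplex h) (simplex n).
Proof. by exists (fun k (f : subsimplex h k) => sval f : simplex n k). Defined.

Definition in_boundary n k (f : dhom k n) : bool :=
  [exists j, j \notin codom f].

Lemma boundary_stable n : stable (@in_boundary n).
Proof.
move=> k l a f /existsP[j jf]; apply/existsP; exists j.
by apply: contra jf => /codomP[i ->]; apply: codom_f.
Qed.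

Definition boundary n : sset := subsimplex (@boundary_stable n).
Definition boundary_incl n : shom (boundary n) (simplex n) :=
  subsimplex_incl (@boundary_stable n).

Definition in_horn n (i : 'I_n.+1) k (f : dhom k n) : bool :=
  [exists j, (j != i) && (j \notin codom f)].

Lemma horn_stable n (i : 'I_n.+1) : stable (in_horn i).
Proof.
move=> k l a f /existsP[j /andP[ji jf]]; apply/existsP; exists j.
by rewrite ji; apply: contra jf => /codomP[x ->]; apply: codom_f.
Qed.

Definition horn n (i : 'I_n.+1) : sset := subsimplex (@horn_stable n i).
Definition horn_incl n (i : 'I_n.+1) : shom (horn i) (simplex n) :=
  subsimplex_incl (@horn_stable n i).

Definition Kan_fibration (X Y : sset) (p : shom X Y) : Prop :=
  forall n (i : 'I_n.+1), 0 < n ->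
  forall (u : shom (horn i) X) (v : shom (simplex n) Y),
    (forall k x, p k (u k x) = v k (horn_incl i k x)) ->
  exists w : shom (simplex n) X,
    (forall k x, w k (horn_incl i k x) = u k x) /\
    (forall k x, p k (w k x) = v k x).

Definition Kan_complex (K : sset) : Prop := Kan_fibration (to_point K).

Definition shomotopy (X Y : sset) (f g : shom X Y) : Prop :=
  exists h : shom (sprod X (simplex 1)) Y, forall n (x : X n),
    h n (x, dconst n ord0) = f n x /\ h n (x, dconst n ord_max) = g n x.

(* f and g lie in the same connected component of the mapping space. *)
Definition homotopic (X Y : sset) : shom X Y -> shom X Y -> Prop :=
  clos_refl_sym_trans _ (@shomotopy X Y).

(* Weak homotopy equivalence: for every Kan complex K, precomposition with f
   is a bijection [Y, K] -> [X, K] on homotopy classes of maps. *)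
Definition Kan_equivalence (X Y : sset) (f : shom X Y) : Prop :=
  forall K : sset, Kan_complex K ->
    (forall g h : shom Y K,
       homotopic (scomp g f) (scomp h f) -> homotopic g h) /\
    (forall g : shom X K, exists h : shom Y K, homotopic (scomp h f) g).

Lemma factor_square (A B C D B' : sset) (t : shom A B) (l : shom A C)
  (r : shom B D) (b : shom C D) (w : shom B B') (q : shom B' D) :
  (forall n x, r n (t n x) = b n (l n x)) ->
  (forall n x, q n (w n x) = r n x) ->
  forall n x, q n (scomp w t n x) = b n (l n x).
Proof. by move=> e e' n x; rewrite /= e' e. Qed.

(* The commutative square
       A --t--> B
       |l       |r
       C --b--> D
   is a homotopy pullback if, for every factorization of r as a Kan
   equivalence w : B -> B' followed by a Kan fibration q : B' -> D, the
   induced map from A to the pullback of q and b is a Kan equivalence. *)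
Definition homotopy_pullback (A B C D : sset) (t : shom A B) (l : shom A C)
    (r : shom B D) (b : shom C D)
    (e : forall n x, r n (t n x) = b n (l n x)) : Prop :=
  forall (B' : sset) (w : shom B B') (q : shom B' D)
    (e' : forall n x, q n (w n x) = r n x),
  Kan_equivalence w -> Kan_fibration q ->
  Kan_equivalence (spullback_pair (factor_square e e')).

Record sspace := SSpace {
  sp_ob :> nat -> sset;
  sp_act : forall m n, dhom m n -> shom (sp_ob n) (sp_ob m);
  sp_act_id : forall n l (x : sp_ob n l), sp_act (did n) l x = x;
  sp_act_comp : forall m n p (g : dhom n p) (f : dhom m n) l (x : sp_ob p l),
    sp_act (dcomp g f) l x = sp_act f l (sp_act g l x) }.

Arguments sp_act {s m n} a.

Record sphom (X Y : sspace) := SpHom {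
  sphom_fun :> forall n, shom (X n) (Y n);
  sphom_nat : forall m n (a : dhom m n) l (x : X n l),
    sphom_fun m l (sp_act a l x) = sp_act a l (sphom_fun n l x) }.

Lemma shomP (X Y : sset) (f g : shom X Y) :
  (forall n x, f n x = g n x) -> f = g.
Proof.
case: f g => [f fn] [g gn] /= fg.
have e : f = g by apply: functional_extensionality_dep => n; apply: funext.
by subst g; rewrite (Prop_irrelevance fn gn).
Qed.

Lemma sphomP (X Y : sspace) (f g : sphom X Y) :
  (forall n l x, f n l x = g n l x) -> f = g.
Proof.
case: f g => [f fn] [g gn] /= fg.
have e : f = g.
  by apply: functional_extensionality_dep => n; apply: shomP.
by subst g; rewrite (Prop_irrelevance fn gn).
Qed.

Definition spcomp (X Y Z : sspace) (g : sphom Y Z) (f : sphom X Y) :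
  sphom X Z.
Proof.
by exists (fun n => scomp (g n) (f n)) => m n a l x /=; rewrite !sphom_nat.
Defined.

Definition sid (X : sset) : shom X X.
Proof. by exists (fun n x => x). Defined.

Definition spid (X : sspace) : sphom X X.
Proof. by exists (fun n => sid (X n)). Defined.

Definition spprod (X Y : sspace) : sspace.
Proof.
exists (fun n => sprod (X n) (Y n))
  (fun m n a => sprod_map (sp_act a) (sp_act a)).
- by move=> n l [x y] /=; rewrite !sp_act_id.
- by move=> m n p g f l [x y] /=; rewrite !sp_act_comp.
Defined.

Definition spprod_map (X X' Y Y' : sspace) (f : sphom X X') (g : sphom Y Y') :
  sphom (spprod X Y) (spprod X' Y').
Proof.
exists (fun n => sprod_map (f n) (g n)
          : shom (spprod X Y n) (spprod X' Y' n)).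
by move=> m n a l [x y] /=; rewrite !sphom_nat.
Defined.

(* A space K as a constant simplicial space: (k, l) |-> K_l. *)
Definition const_sp (K : sset) : sspace.
Proof. by exists (fun _ => K) (fun _ _ _ => sid K). Defined.

Definition const_sp_map (K L : sset) (f : shom K L) :
  sphom (const_sp K) (const_sp L).
Proof. by exists (fun _ => f : shom (const_sp K _) (const_sp L _)). Defined.

Definition discrete (T : Type) : sset.
Proof. by exists (fun _ => T) (fun _ _ _ x => x). Defined.

Definition discrete_map (S T : Type) (f : S -> T) :
  shom (discrete S) (discrete T).
Proof. by exists (fun _ => f : discrete S _ -> discrete T _). Defined.

(* A simplicial set A as a levelwise discrete simplicial space:
   (k, l) |-> A_k. *)
Definition disc_sp (A : sset) : sspace.
Proof.
exists (fun k => discrete (A k)) (fun _ _ a => discrete_map (act a)).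
- by move=> n l x; exact: (@act_id A n x).
- by move=> m n p g f l x; exact: (@act_comp A m n p g f x).
Defined.

Definition disc_sp_map (A B : sset) (f : shom A B) :
  sphom (disc_sp A) (disc_sp B).
Proof.
exists (fun n => discrete_map (f n)
          : shom (disc_sp A n) (disc_sp B n)).
by move=> m n a l x /=; apply: shom_nat.
Defined.

Definition F n : sspace := disc_sp (simplex n).
Definition dF n : sspace := disc_sp (boundary n).
Definition dF_incl n : sphom (dF n) (F n) := disc_sp_map (boundary_incl n).

Definition in_spine n k (f : dhom k n) : bool := f ord_max - f ord0 <= 1.

Lemma spine_stable n : stable (@in_spine n).
Proof.
move=> k l a f; rewrite /in_spine; apply: leq_trans.
by apply: leq_sub; apply: dmono; rewrite // -ltnS.
Qed.

Definition G n : sspace := disc_sp (subsimplex (@spine_stable n)).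
Definition G_incl n : sphom (G n) (F n) :=
  disc_sp_map (subsimplex_incl (@spine_stable n)).

Definition to_F0 (X : sspace) : sphom X (F 0).
Proof.
unshelve eexists.
- move=> n; exists (fun _ _ => dconst n ord0 : simplex 0 n); exact: (fun _ _ _ _ => erefl).
- by move=> m n a l x; apply: dhomP.
Defined.

Definition Map (X Y : sspace) : sset.
Proof.
exists (fun n => sphom (spprod X (const_sp (simplex n))) Y)
  (fun m n a f => spcomp f (spprod_map (spid X) (const_sp_map (simplex_map a)))).
- by move=> n f; apply: sphomP => k l [x y] /=; congr (f _ _ (_, _)); apply: dhomP.
- move=> m n p g a f; apply: sphomP => k l [x y] /=.
  by congr (f _ _ (_, _)); apply: dhomP.
Defined.

Definition Map_pre (X X' Y : sspace) (i : sphom X X') :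
  shom (Map X' Y) (Map X Y).
Proof.
exists (fun n (f : Map X' Y n) =>
  spcomp f (spprod_map i (spid (const_sp (simplex n)))) : Map X Y n).
by move=> m n a f; apply: sphomP.
Defined.

Definition Map_post (X Y Y' : sspace) (p : sphom Y Y') :
  shom (Map X Y) (Map X Y').
Proof.
exists (fun n (f : Map X Y n) => spcomp p f : Map X Y' n).
by move=> m n a f; apply: sphomP.
Defined.

Lemma Map_square (A B Y X : sspace) (i : sphom A B) (p : sphom Y X) n
    (f : Map B Y n) :
  Map_post A p n (Map_pre Y i n f) = Map_pre X i n (Map_post B p n f).
Proof. exact: sphomP. Qed.

Definition matching_map (Y X : sspace) (p : sphom Y X) n :
    shom (Map (F n) Y)
      (spullback (Map_post (dF n) p) (Map_pre X (dF_incl n))) :=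
  spullback_pair (Map_square (dF_incl n) p).

Definition Reedy_fibration (Y X : sspace) (p : sphom Y X) : Prop :=
  forall n, Kan_fibration (matching_map p n).

Definition Reedy_fibrant (W : sspace) : Prop := Reedy_fibration (to_F0 W).

(* The Yoneda isomorphism W_n = Map(F(n), W). *)
Definition yoneda_map (W : sspace) n l (w : W n l) :
  sphom (spprod (F n) (const_sp (simplex l))) W.
Proof.
unshelve eexists.
- move=> k; exists (fun j (z : spprod (F n) (const_sp (simplex l)) k j) =>
    sp_act (z.1 : dhom k n) j (act (z.2 : dhom j l) w)).
  by move=> i j a [f b] /=; rewrite act_comp shom_nat.
- by move=> i j a m [f b] /=; rewrite sp_act_comp.
Defined.

Definition yoneda (W : sspace) n : shom (W n) (Map (F n) W).
Proof.
exists (fun l w => yoneda_map w : Map (F n) W l).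
by move=> l m a w; apply: sphomP => i j [f b] /=; rewrite act_comp.
Defined.

Definition Segal_map (W : sspace) n : shom (W n) (Map (G n) W) :=
  scomp (Map_pre W (G_incl n)) (yoneda W n).

Definition Segal_space (W : sspace) : Prop :=
  Reedy_fibrant W /\ forall n, 2 <= n -> Kan_equivalence (Segal_map W n).

Definition vertex0 (X : sspace) n : shom (X n) (X 0) :=
  sp_act (dconst 0 (ord0 : 'I_n.+1)).

Lemma vertex0_square (L X : sspace) (p : sphom L X) n l (x : L n l) :
  p 0 l (vertex0 L n l x) = vertex0 X n l (p n l x).
Proof. exact: sphom_nat. Qed.

Definition left_fibration (L X : sspace) (p : sphom L X) : Prop :=
  Reedy_fibration p /\
  forall n, 1 <= n -> homotopy_pullback (@vertex0_square L X p n).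

Definition precomp (D : dfunctor) (X : sspace) : sspace.
Proof.
exists (fun n => X (D n)) (fun m n a => sp_act (dF_map D a)).
- by move=> n l x; rewrite dF_id sp_act_id.
- by move=> m n p g f l x; rewrite dF_comp sp_act_comp.
Defined.

Definition Tw (W : sspace) : sspace := precomp Q W.
Definition op (W : sspace) : sspace := precomp opD W.

Definition pair_map (X Y Z : sspace) (f : sphom X Y) (g : sphom X Z) :
  sphom X (spprod Y Z).
Proof.
unshelve eexists.
- move=> n; exists (fun l x => (f n l x, g n l x) : spprod Y Z n l).
  by move=> k l a x /=; rewrite !shom_nat.
- by move=> m n a l x /=; rewrite !sphom_nat.
Defined.

Definition Tw_source (W : sspace) : sphom (Tw W) (op W).
Proof.
exists (fun n => sp_act (Qinl n) : shom (Tw W n) (op W n)).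
by move=> m n a l x /=; rewrite -!sp_act_comp Qinl_nat.
Defined.

Definition Tw_target (W : sspace) : sphom (Tw W) W.
Proof.
exists (fun n => sp_act (Qinr n) : shom (Tw W n) (W n)).
by move=> m n a l x /=; rewrite -!sp_act_comp Qinr_nat.
Defined.

Definition Tw_proj (W : sspace) : sphom (Tw W) (spprod (op W) W) :=
  pair_map (Tw_source W) (Tw_target W).

(* Main.v *)
Require Import Defs.
From mathcomp Require Import all_boot zify.
From mathcomp Require Import boolp classical_sets.
From Stdlib Require Import Relation_Operators.

Set Implicit Arguments.
Unset Strict Implicit.
Unset Printing Implicit Defensive.

(** Write p : L -> X for the projection Tw W -> W^op x W, so that L_n is
    W_(2n+1) and X_n is W_n x W_n.

    Everything rests on one extension principle
    ([trivial_fibration_extends]): a map of simplicial sets that lifts against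
    the boundary inclusions lifts against all inclusions of simplicial
    subsets.  It is applied to two families of maps.

    The first family turns Kan fibrations into homotopy theory.  If q : E -> D
    is a Kan fibration, then path space E -> E x_D (path space D) lifts against
    boundaries, because a prism is filled one shuffle at a time
    ([prism_lift]).  Hence homotopies can be lifted along q, relative to a
    subset on which a lift is given.  Dold's argument then shows that an
    equivalence between two fibrations over D with Kan total spaces has an
    inverse over D up to homotopy over D ([homotopy_inverses_over]).  Such data
    can be pulled back along any C -> D; and when the target fibration is the
    identity of D the data are a section of q with a fibrewise deformation
    onto it.

    The second family turns Reedy fibrancy of W into a filling property.  For
    a horn in Delta[m], restriction from the simplicial set k |-> (W_k)_m to
    horns in the W_k lifts against boundaries.  So a horn in W_N can be filled
    with values on an arbitrary simplicial subset of Delta[N] prescribed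
    ([simplex_filler]).

    Reedy condition.  A lifting problem for the n-th matching map of p is a
    horn in W_(2n+1) whose filler is prescribed on the simplices of
    [n]^op * [n] that lie in one of the two factors, or that avoid both copies
    of some vertex.  These prescriptions agree where they overlap, because a
    nonempty set of vertices J of [n] is the image of a monotone retraction e and the
    simplices with vertices over J are those fixed by Q(e) ([Tw_filler]).

    Homotopy pullback condition.  As p_0 is a Kan fibration, replacing
    L_0 -> X_0 by an equivalent fibration does not change the pullback along
    X_n -> X_0 up to equivalence.  So it is enough that
    W_(2n+1) -> W_n x_(W_0) W_1 x_(W_0) W_n is an equivalence.  Its target
    maps to Map(G(2n+1), W), a spine of 2n+1 edges, by restricting both outer
    factors to their spines, and the composite is the Segal map.  The second
    map is an equivalence as well: the Segal map of W_n has a section and a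
    deformation over Map(G(n), W), and these do not move vertices, so they can
    be used on the two outer factors at once
    ([spine_comparison_equivalence]).  Two out of three finishes the
    proof. *)

(** * Partial lifts and trivial fibrations *)

Definition lifts (S A E B : sset) (j : shom S A) (r : shom E B) : Prop :=
  forall (u : shom S E) (v : shom A B),
    (forall k x, r k (u k x) = v k (j k x)) ->
  exists w : shom A E,
    (forall k x, w k (j k x) = u k x) /\ (forall k x, r k (w k x) = v k x).

Definition trivial_fibration (E B : sset) (r : shom E B) : Prop :=
  forall n, lifts (boundary_incl n) r.

(** A lift of v through r that is defined on a simplicial subset of A is encoded
    by its graph.  Unions of chains and the adjunction of one cell then need no
    dependent domains; the domain is the set of a with R k a x for some x. *)
Record partial_lift (A E B : sset) (r : shom E B) (v : shom A B)
    (R : forall k, A k -> E k -> Prop) : Prop := PartialLift {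
  pl_act : forall k l (f : dhom k l) a x, R l a x -> R k (act f a) (act f x);
  pl_fun : forall k a x y, R k a x -> R k a y -> x = y;
  pl_over : forall k a x, R k a x -> r k x = v k a }.

Lemma total_lift (A E B : sset) (r : shom E B) (v : shom A B) R :
  partial_lift r v R -> (forall k a, exists x, R k a x) ->
  exists w : shom A E, (forall k a, R k a (w k a)) /\
    (forall k a, r k (w k a) = v k a).
Proof.
move=> [Ra Rf Ro] tot.
have ex k a : {x | R k a x} by apply: cid.
unshelve eexists.
  exists (fun k a => sval (ex k a)) => m n f a.
  by apply: Rf (svalP (ex _ _)) _; apply: Ra; apply: svalP.
by split=> k a /=; [|apply: Ro]; apply: svalP.
Qed.

Lemma dcompA m n p q (h : dhom p q) (g : dhom n p) (f : dhom m n) :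
  dcomp h (dcomp g f) = dcomp (dcomp h g) f.
Proof. exact: dhomP. Qed.

Lemma dcomp1r m n (f : dhom m n) : dcomp f (did m) = f.
Proof. exact: dhomP. Qed.

Lemma dcomp1l m n (f : dhom m n) : dcomp (did n) f = f.
Proof. exact: dhomP. Qed.

(** The map Delta[n] -> A that corresponds to a under the Yoneda lemma. *)
Definition classify (A : sset) n (a : A n) : shom (simplex n) A.
Proof.
exists (fun k (f : simplex n k) => act (f : dhom k n) a) => k l f g.
exact: act_comp.
Defined.

(** Attaching one cell to the domain of a partial lift.  The cell a meets the
    domain in the simplicial subset P of Delta[n], and away from P distinct
    simplices of Delta[n] stay distinct in A, so a lift on Delta[n] relative to
    P can be added to the graph.  It is used with P a boundary and with P a
    horn. *)
Lemma cell_step (A E B : sset) (r : shom E B) (v : shom A B) R n (a : A n)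
    (P : forall k, pred (dhom k n)) (hP : stable P) :
  partial_lift r v R -> lifts (subsimplex_incl hP) r ->
  (forall k f, P k f <-> exists x, R k (act f a) x) ->
  (forall k f g, ~~ P k f -> ~~ P k g -> act f a = act g a -> f = g) ->
  exists R', [/\ partial_lift r v R',
    forall k b x, R k b x -> R' k b x &
    forall k b, (exists x, R' k b x) <->
      (exists x, R k b x) \/ exists f, b = act f a].
Proof.
move=> [Ra Rf Ro] ext Pdom inj.
have ex k (f : subsimplex hP k) : {x | R k (act (sval f) a) x}.
  by apply: cid; apply/Pdom; case: f.
have [u uE] : exists u : shom (subsimplex hP) E,
    forall k f, R k (act (sval f) a) (u k f).
  unshelve eexists.
    exists (fun k f => sval (ex k f)) => k l f g.
    apply: (Rf _ _ _ _ (svalP (ex k (act f g)))); rewrite /= act_comp.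
    by apply: Ra; apply: svalP.
  by move=> k f /=; apply: svalP.
have [k f|w [wu wv]] := ext u (scomp v (classify a)).
  by rewrite (Ro _ _ _ (uE k f)).
have wnat k l (f : dhom k l) (g : dhom l n) :
    w k (dcomp g f) = act f (w l g) := shom_nat w f (g : simplex n l).
have wR k f x : R k (act f a) x -> w k f = x.
  move=> Rx; have Pf : P k f by apply/Pdom; exists x.
  by rewrite (wu k (exist _ f Pf)); apply: Rf Rx; apply: (uE k (exist _ f Pf)).
exists (fun k b x => R k b x \/ exists f, b = act f a /\ x = w k f).
split; last 2 first.
- by move=> k b x; left.
- move=> k b; split=> [[x [Rx|[f [-> _]]]]|[[x Rx]|[f ->]]].
  + by left; exists x.
  + by right; exists f.
  + by exists x; left.
  + by exists (w k f); right; exists f.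
split.
- move=> k l f b x [Rx|[g [-> ->]]]; first by left; apply: Ra.
  by right; exists (dcomp g f); rewrite act_comp wnat.
- move=> k b x y [Rx|[f [-> ->]]] [Ry|[g [e ->]]].
  + exact: Rf Rx Ry.
  + by rewrite e in Rx; rewrite (wR _ _ _ Rx).
  + exact: wR Ry.
  + have [Pf|nPf] := boolP (P k f).
      have [z Rx] := (Pdom k f).1 Pf.
      by rewrite (wR _ _ _ Rx); rewrite e in Rx; rewrite (wR _ _ _ Rx).
    have [Pg|nPg] := boolP (P k g).
      have [z Rx] := (Pdom k g).1 Pg.
      by rewrite (wR _ _ _ Rx); rewrite -e in Rx; rewrite (wR _ _ _ Rx).
    by rewrite (inj k f g).
- by move=> k b x [/Ro//|[f [-> ->]]]; rewrite wv.
Qed.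

Lemma lift_mono n (j : 'I_n.+2) (x y : 'I_n.+1) : x <= y -> lift j x <= lift j y.
Proof. by rewrite /= leq_bump2. Qed.

Definition dface n (j : 'I_n.+2) : dhom n n.+1 := DHom (@lift_mono n j).

Lemma miss_factor m n (f : dhom m n) :
  in_boundary f -> exists n' (d : dhom n' n) (g : dhom m n'),
    n' < n /\ f = dcomp d g.
Proof.
case: n f => [|n] f /existsP[j jf].
  by case/negP: jf; apply/codomP; exists ord0; apply: val_inj; rewrite !ord1.
have nj x : f x != j by apply: contra jf => /eqP <-; apply: codom_f.
have ub x : unbump j (f x) < n.+1.
  have := nj x; rewrite -val_eqE /= /unbump; have := ltn_ord j; have := ltn_ord (f x).
  lia.
have gm (x y : 'I_m.+1) : x <= y -> Ordinal (ub x) <= Ordinal (ub y).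
  move=> /(dmono f) /=; rewrite /unbump; lia.
exists n, (dface j), (DHom gm); split=> //; apply: dhomP => x; apply: val_inj => /=.
have := nj x; rewrite -val_eqE /= /unbump /bump; lia.
Qed.

(** Any choice of preimages under a monotone surjection is itself monotone, so
    a section can be made to pass through a prescribed point. *)
Lemma surj_section m n (f : dhom m n) (i : 'I_m.+1) :
  ~~ in_boundary f -> exists d : dhom n m, dcomp f d = did n /\ d (f i) = i.
Proof.
move=> nb; have ex j : {x | f x = j}.
  apply: cid; move: nb; rewrite negb_exists => /forallP/(_ j); rewrite negbK.
  by case/codomP=> x ->; exists x.
pose d j := if j == f i then i else sval (ex j).
have fd j : f (d j) = j.
  by rewrite /d; case: eqP => [->//|_]; exact: (svalP (ex j)).
have dm (x y : 'I_n.+1) : x <= y -> d x <= d y.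
  rewrite leq_eqVlt => /predU1P[/val_inj->//|xy]; apply: ltnW.
  by rewrite ltnNge; apply/negP => /(dmono f); rewrite !fd leqNgt xy.
exists (DHom dm); split; last by rewrite /= /d eqxx.
by apply: dhomP => j /=; apply: fd.
Qed.

(** A section of f is strictly increasing, so its value at m is at least m, and
    by symmetry at most m. *)
Lemma surj_endo n (f : dhom n n) : ~~ in_boundary f -> f = did n.
Proof.
move=> nb; have [d [fd _]] := surj_section ord0 nb.
have dinj : injective d.
  have fK x : f (d x) = x by have := congr1 (fun g : dhom n n => g x) fd.
  exact: can_inj fK.
have dlt (x y : 'I_n.+1) : x < y -> d x < d y.
  move=> xy; rewrite ltn_neqAle (dmono d (ltnW xy)) andbT; apply/eqP => /val_inj/dinj e.
  by rewrite e ltnn in xy.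
have dge m (h : m < n.+1) : m <= d (Ordinal h).
  elim: m h => // m IH h; have h' : m < n.+1 by apply: ltnW.
  by apply: leq_ltn_trans (IH h') _; apply: dlt => /=.
have dle m (h : m < n.+1) : d (rev_ord (Ordinal h)) <= n - m.
  elim: m h => [|m IH] h; first by rewrite subn0 -ltnS.
  have h' : m < n.+1 by apply: ltnW.
  have := IH h'; have : d (rev_ord (Ordinal h)) < d (rev_ord (Ordinal h')).
    by apply: dlt => /=; lia.
  lia.
have dE x : d x = x.
  apply: val_inj; apply/eqP; rewrite eqn_leq; case: x => m h; rewrite dge andbT.
  have h2 : n - m < n.+1 by lia.
  have -> : Ordinal h = rev_ord (Ordinal h2) by apply: val_inj => /=; lia.
  by have := dle _ h2; rewrite /= subSS.
by rewrite -fd; apply: dhomP => x /=; rewrite dE.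
Qed.

(** Take a maximal partial lift and, if its domain is not all of A, a simplex a
    of least dimension outside it.  A face of a lies in the domain by
    minimality, while a degeneracy of a does not, since it has a as a face; so
    the domain pulls back to the boundary along a.  Surjections f and g with
    act f a = act g a agree (the Eilenberg-Zilber argument): a section of f is
    also a section of g.  Hence the cell a can be attached. *)
Lemma trivial_fibration_extends (A E B : sset) (r : shom E B) (v : shom A B) R :
  trivial_fibration r -> partial_lift r v R ->
  exists w : shom A E, (forall k a x, R k a x -> w k a = x) /\
    (forall k a, r k (w k a) = v k a).
Proof.
move=> tr plR.
pose T := {R' | partial_lift r v R' /\ forall k a x, R k a x -> R' k a x}.
pose le (s t : T) := `[< forall k a x, sval s k a x -> sval t k a x >].
have [||C Ctot|[M [plM RM]] Mmax] :=
    @ZL_preorder T (exist _ R (conj plR (fun _ _ _ h => h))) le.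
- by move=> t; apply/asboolP.
- by move=> s t t' /asboolP h /asboolP h'; apply/asboolP => k a x /h /h'.
- have [[s0 Cs0]|C0] := pselect (exists s, C s); last first.
    exists (exist _ R (conj plR (fun _ _ _ h => h))) => s Cs.
    by case: C0; exists s.
  pose U k a x := exists s, C s /\ sval s k a x.
  have plU : partial_lift r v U.
    split.
    + move=> k l f a x [s [Cs sx]]; exists s; split=> //.
      exact: (pl_act (svalP s).1).
    + move=> k a x y [s [Cs sx]] [t [Ct ty]].
      case: (Ctot _ _ Cs Ct) => /asboolP h.
        by apply: (pl_fun (svalP t).1) ty; apply: h.
      by apply: (pl_fun (svalP s).1) sx _; apply: h.
    + by move=> k a x [s [Cs sx]]; apply: (pl_over (svalP s).1 sx).
  have RU k a x : R k a x -> U k a x.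
    by move=> Rx; exists s0; split=> //; apply: (svalP s0).2.
  by exists (exist _ U (conj plU RU)) => s Cs; apply/asboolP => k a x sx; exists s.
suff tot k a : exists x, M k a x.
  have [w [Mw rw]] := total_lift plM tot; exists w; split=> // k a x Rx.
  by apply: (pl_fun plM) (Mw _ _) _; exact: (RM k a x Rx).
elim/ltn_ind: k a => n IH a; apply: contrapT => nMa.
(* No degeneracy of a lies in the domain, since a is a face of it. *)
have nS m (f : dhom m n) (d : dhom n m) :
    dcomp f d = did n -> ~ exists x, M m (act f a) x.
  move=> fd [x Mx]; apply: nMa; exists (act d x).
  by have := pl_act plM d Mx; rewrite -act_comp fd act_id.
have bM k (f : dhom k n) : in_boundary f <-> exists x, M k (act f a) x.
  split=> [/miss_factor[n' [d [g [n'n ->]]]]|Mf].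
    have [x Mx] := IH n' n'n (act d a).
    by exists (act g x); rewrite act_comp; apply: (pl_act plM).
  apply: contraT => /(surj_section ord0)[d [fd _]].
  by case: (nS _ _ _ fd Mf).
have [k f g nf ng e|M' [plM' MM' M'E]] := cell_step plM (tr n) bM.
  apply: dhomP => i; have [d [fd di]] := surj_section i nf.
  have gd : dcomp g d = did n.
    apply: surj_endo; apply/negP => /bM; rewrite act_comp -e -act_comp fd act_id.
    exact: nMa.
  by rewrite -{2}di; exact: esym (congr1 (fun h : dhom n n => h (f i)) gd).
have M'R k b x : R k b x -> M' k b x by move=> Rx; apply/MM'/RM.
have /asboolP M'M := Mmax (exist _ M' (conj plM' M'R)) (asboolT MM').
have [|x M'x] := (M'E n a).2; first by right; exists (did n); rewrite act_id.
by apply: nMa; exists x; apply: M'M.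
Qed.

(** * Prisms *)

Lemma in_boundaryP n k (f : dhom k n) :
  in_boundary f <-> exists j, forall x, f x != j.
Proof.
split=> [/existsP[j jf]|[j jf]].
  by exists j => x; apply: contra jf => /eqP <-; apply: codom_f.
by apply/existsP; exists j; apply/codomP => -[x e]; have := jf x; rewrite e eqxx.
Qed.

Lemma in_hornP n (i : 'I_n.+1) k (f : dhom k n) :
  in_horn i f <-> exists j, j != i /\ forall x, f x != j.
Proof.
split=> [/existsP[j /andP[ji jf]]|[j [ji jf]]].
  by exists j; split=> // x; apply: contra jf => /eqP <-; apply: codom_f.
apply/existsP; exists j; rewrite ji.
by apply/codomP => -[x e]; have := jf x; rewrite e eqxx.
Qed.

Lemma bool_lt2 (b : bool) : b < 2.
Proof. by case: b. Qed.

Lemma shuffle_left_bound n i (x : 'I_n.+2) : i <= n ->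
  x - (i < x) < n.+1.
Proof. by have := ltn_ord x; case: ltnP; lia. Qed.

Lemma shuffle_left_mono n i (hi : i <= n) (x y : 'I_n.+2) : x <= y ->
  Ordinal (shuffle_left_bound x hi) <= Ordinal (shuffle_left_bound y hi).
Proof. by move=> /=; case: ltnP; case: ltnP; lia. Qed.

Definition shuffle_left n i (hi : i <= n) : dhom n.+1 n :=
  DHom (shuffle_left_mono hi).

Lemma shuffle_right_mono n i (x y : 'I_n.+2) : x <= y ->
  (inord (i < x) : 'I_2) <= (inord (i < y) : 'I_2).
Proof. by rewrite !inordK; case: ltnP; case: ltnP => //; lia. Qed.

Definition shuffle_right n i : dhom n.+1 1 := DHom (@shuffle_right_mono n i).

(** The shuffle (0,0), ..., (i,0), (i,1), ..., (n,1), a top-dimensional simplex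
    of the prism Delta[n] x Delta[1]. *)
Definition shuffle n i (hi : i <= n) : sprod (simplex n) (simplex 1) n.+1 :=
  (shuffle_left hi, shuffle_right n i).

Lemma shuffle_injective n i (hi : i <= n) k (f g : dhom k n.+1) :
  act f (shuffle hi) = act g (shuffle hi) -> f = g.
Proof.
move=> [e1 e2]; apply: dhomP => x; apply: val_inj => /=.
have := congr1 (fun h => val (h x)) e1.
have := congr1 (fun h => val (h x)) e2.
rewrite /= !inordK ?bool_lt2 //.
by case: ltnP; case: ltnP; lia.
Qed.

(** Call a simplex (f, g) of the prism j-admissible if f misses a vertex or if
    f x >= j whenever g x = 1.  The i-th shuffle meets the (i+1)-admissible
    simplices exactly in its i-th horn: a simplex of it that misses vertex i+1
    is (i+1)-admissible, one that misses another vertex than i and i+1 has f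
    missing a vertex, and the face opposite to i is the one that is new. *)
Lemma shuffle_horn n i (hi : i <= n) k (f : dhom k n.+1) (c : 'I_n.+2) :
  val c = i ->
  in_horn c f <->
  in_boundary (dcomp (shuffle_left hi) f) \/
    forall x, 0 < dcomp (shuffle_right n i) f x ->
      i < dcomp (shuffle_left hi) f x.
Proof.
move=> ci; rewrite in_hornP in_boundaryP; split=> [[j [jc fj]]|].
  have jv : j != i :> nat by rewrite -ci.
  have fj' x : f x != j :> nat by have := fj x; rewrite -val_eqE.
  have [e|ne] := eqVneq (j : nat) i.+1.
    right=> x /=; rewrite inordK ?bool_lt2 //.
    by have := fj' x; rewrite e /=; case: ltnP => //; lia.
  left; have hb : j - (i < j) < n.+1 by apply: shuffle_left_bound.
  exists (Ordinal hb) => x; have := fj' x; rewrite -!val_eqE /=.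
  by case: ltnP; case: ltnP; lia.
case=> [[j fj]|h].
  have fj' x : f x - (i < f x) != j :> nat by have := fj x; rewrite -val_eqE.
  have hb : j + (i <= j) < n.+2 by have := ltn_ord j; case: leqP; lia.
  exists (Ordinal hb); rewrite -val_eqE /= ci; split; first by case: leqP; lia.
  by move=> x; have := fj' x; rewrite -!val_eqE /=; case: ltnP; case: leqP; lia.
have hb : i.+1 < n.+2 by lia.
exists (Ordinal hb); rewrite -val_eqE /= ci; split; first by lia.
move=> x; have := h x; rewrite -!val_eqE /= inordK ?bool_lt2 //.
by case: ltnP; lia.
Qed.

(** Between i-admissibility and (i+1)-admissibility there is only the i-th
    shuffle: the face map of (f, g) into it is x |-> f x + g x. *)
Lemma shuffle_cover n i (hi : i <= n) k (f : dhom k n) (g : dhom k 1) :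
  (forall x, 0 < g x -> i <= f x) -> ~ (forall x, 0 < g x -> i < f x) ->
  exists h, ((f, g) : sprod (simplex n) (simplex 1) k) = act h (shuffle hi).
Proof.
move=> ge ngt.
have [x0 [gx0 fx0]] : exists x0, 0 < g x0 /\ f x0 <= i.
  apply: contrapT => no; apply: ngt => x gx; rewrite ltnNge; apply/negP => fx.
  by apply: no; exists x.
have g2 x : g x < 2 by apply: ltn_ord.
have hb x : f x + g x < n.+2 by have := ltn_ord (f x); have := g2 x; lia.
have hm (x y : 'I_k.+1) : x <= y -> Ordinal (hb x) <= Ordinal (hb y).
  by move=> xy /=; apply: leq_add; apply: dmono.
(* The vertex x0 lies over the end 1 and has f x0 = i, so the vertices over 0
   come before it. *)
have low x : g x = 0 :> nat -> f x <= i.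
  move=> gx; apply: leq_trans fx0; apply: dmono; rewrite leqNgt; apply/negP => /ltnW.
  by move=> /(dmono g); rewrite gx; lia.
exists (DHom hm); congr (_, _); apply: dhomP => x; apply: val_inj => /=.
  have := low x; have := ge x; have := g2 x.
  by case: (val (g x)) => [|[|//]]; case: ltnP; lia.
have := low x; have := ge x; have := g2 x.
rewrite inordK ?bool_lt2 //.
by case: (val (g x)) => [|[|//]]; case: ltnP; lia.
Qed.

(** The shuffles i = n, ..., 0 are attached to the boundary and the bottom of the
    prism in this order, each along its i-th horn. *)
Lemma prism_lift (X Y : sset) (p : shom X Y) n
    (v : shom (sprod (simplex n) (simplex 1)) Y) R :
  Kan_fibration p -> partial_lift p v R ->
  (forall k (f : dhom k n) (g : dhom k 1),
    (exists x, R k (f, g) x) <-> in_boundary f \/ g = dconst k ord0) ->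
  exists w : shom (sprod (simplex n) (simplex 1)) X,
    (forall k a x, R k a x -> w k a = x) /\
    (forall k a, p k (w k a) = v k a).
Proof.
move=> Kp plR Rdom.
(* After j cells, the domain consists of the (n + 1 - j)-admissible simplices. *)
have step j : j <= n.+1 -> exists R',
    [/\ partial_lift p v R', forall k a x, R k a x -> R' k a x &
    forall k (f : dhom k n) (g : dhom k 1),
      (exists x, R' k (f, g) x) <->
      in_boundary f \/ forall x, 0 < g x -> n.+1 - j <= f x].
  elim: j => [|j IH] jn.
    exists R; split=> // k f g; rewrite Rdom subn0.
    split=> [[|->]|[|h]]; [by left|by right|by left|right].
    apply: dhomP => x; apply: val_inj => /=; apply/eqP; rewrite -leqn0 leqNgt.
    by apply/negP => /h; rewrite leqNgt ltn_ord.
  have [R1 [plR1 RR1 R1dom]] := IH (ltnW jn).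
  have hi : n - j <= n by apply: leq_subr.
  have e1 : n.+1 - j = (n - j).+1 by rewrite subSn.
  have cb : n - j < n.+2 by lia.
  rewrite e1 in R1dom; pose c : 'I_n.+2 := Ordinal cb.
  have [|||R2 [plR2 R12 R2dom]] := @cell_step _ _ _ p v R1 n.+1 (shuffle hi)
      (@in_horn n.+1 c) (@horn_stable _ c) plR1.
  + exact: (Kp n.+1 c).
  + by move=> k f; rewrite (@shuffle_horn n (n - j) hi k f c) // -R1dom.
  + by move=> k f g _ _; apply: shuffle_injective.
  exists R2; split=> // [k a x /RR1/R12//|k f g].
  rewrite R2dom R1dom subSS; split=> [[[|h]|[h [-> ->]]]|[|h]].
  + by left.
  + by right=> x /h/ltnW.
  + right=> x /=; rewrite inordK ?bool_lt2 //.
    by case: ltnP => //=; lia.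
  + by left; left.
  + have [h'|h'] := pselect (forall x, 0 < g x -> n - j < f x).
      by left; right.
    by right; apply: shuffle_cover.
have [R' [plR' RR' R'dom]] := step n.+1 (leqnn _).
have [|w [R'w pw]] := total_lift plR'.
  by move=> k [f g]; apply/R'dom; right=> x _; rewrite subnn.
by exists w; split=> // k a x /RR' R'x; apply: (pl_fun plR') (R'w _ _) _.
Qed.

(** * Covering homotopy extension *)

Lemma scompE (X Y Z : sset) (g : shom Y Z) (f : shom X Y) k x :
  scomp g f k x = g k (f k x).
Proof. by []. Qed.

Lemma subsimplex_inj n P (h : @stable n P) k (f g : subsimplex h k) :
  sval f = sval g -> f = g.
Proof. by case: f g => [f pf] [g pg] /= e; apply: eq_exist. Qed.

Lemma spullback_inj (B C D : sset) (r : shom B D) (b : shom C D) k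
    (y z : spullback r b k) :
  (sval y).1 = (sval z).1 -> (sval y).2 = (sval z).2 -> y = z.
Proof.
by case: y z => [[y y'] e] [[z z'] e'] /= yz yz'; apply: eq_exist; congr pair.
Qed.

Definition path_space (X : sset) : sset.
Proof.
exists (fun k => shom (sprod (simplex k) (simplex 1)) X)
  (fun k l a h => scomp h (sprod_map (simplex_map a) (sid _))).
- by move=> k h; apply: shomP => n [f g] /=; rewrite dcomp1l.
- by move=> k l m b a h; apply: shomP => n [f g] /=; rewrite dcompA.
Defined.

Definition path_map (X Y : sset) (p : shom X Y) :
  shom (path_space X) (path_space Y).
Proof.
exists (fun k (h : path_space X k) => scomp p h : path_space Y k).
by move=> k l a h; apply: shomP.
Defined.

Definition path_start (X : sset) : shom (path_space X) X.
Proof.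
exists (fun k (h : path_space X k) => (h : shom _ _) k (did k, dconst k ord0)).
move=> k l a h /=; rewrite -shom_nat /=; congr (h _ (_, _)); exact: dhomP.
Defined.

Lemma path_start_nat (X Y : sset) (p : shom X Y) k (h : path_space X k) :
  p k (path_start X k h) = path_start Y k (path_map p k h).
Proof. by []. Qed.

(** The map X^I -> X x_Y Y^I that remembers the start of a path and its image. *)
Definition path_gap (X Y : sset) (p : shom X Y) :
    shom (path_space X) (spullback p (path_start Y)) :=
  spullback_pair (path_start_nat p).

(** Values of a path family at (a, g) are values of its restriction along a at
    (id, g), so simplices of the latter form determine it. *)
Lemma path_at (X : sset) k l (h : path_space X l) (a : dhom k l) (g : dhom k 1) :
  (h : shom _ _) k (a, g) = (act a h : path_space X k) k (did k, g).
Proof. by rewrite /= dcomp1r. Qed.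

(** A boundary lifting problem for this map is, by adjunction, a lifting problem
    for p against the union of the boundary times Delta[1] and the bottom of
    the prism. *)
Lemma path_gap_trivial (X Y : sset) (p : shom X Y) :
  Kan_fibration p -> trivial_fibration (path_gap p).
Proof.
move=> Kp n u v uv.
have vnat k l (a : dhom k l) (f : dhom l n) :
    v k (dcomp f a) = act a (v l f) := shom_nat v a (f : simplex n l).
have unat k l (a : dhom k l) (f : boundary n l) :
    u k (act a f) = act a (u l f) := shom_nat u a f.
have [V VE] : exists V : shom (sprod (simplex n) (simplex 1)) Y,
    forall k (f : dhom k n) (g : dhom k 1),
      V k (f, g) = ((sval (v k f)).2 : path_space Y k) k (did k, g).
  unshelve eexists.
    exists (fun k z => ((sval (v k z.1)).2 : path_space Y k) k (did k, z.2)).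
    move=> k l a [f g] /=; rewrite vnat /= -shom_nat /=.
    by rewrite dcomp1r dcomp1l.
  by [].
pose R k (z : sprod (simplex n) (simplex 1) k) x :=
  (exists f : boundary n k,
     sval f = z.1 /\ x = (u k f : path_space X k) k (did k, z.2)) \/
  z.2 = dconst k ord0 /\ x = (sval (v k z.1)).1.
have ustart k (f : boundary n k) :
    (u k f : path_space X k) k (did k, dconst k ord0) = (sval (v k (sval f))).1.
  by have := congr1 (fun z => (sval z).1) (uv k f).
have uover k (f : boundary n k) (g : dhom k 1) :
    p k ((u k f : path_space X k) k (did k, g)) = V k (sval f, g).
  rewrite VE.
  by have := congr1 (fun z => ((sval z).2 : path_space Y k) k (did k, g)) (uv k f).
have plR : partial_lift p V R.
  split.
  - move=> k l a [f g] x [[f' [/= e ->]]|[/= e ->]]; [left|right].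
      exists (act a f'); split; first by rewrite /= e.
      by rewrite unat /= -shom_nat /= dcomp1r dcomp1l.
    by split; [rewrite e; apply: dhomP|rewrite vnat].
  - move=> k [f g] x y [[f' [/= e ->]]|[/= e ->]] [[f'' [/= e' ->]]|[/= e' ->]] //.
    + by have -> : f' = f'' by apply: subsimplex_inj; rewrite e e'.
    + by rewrite e' ustart e.
    + by rewrite e ustart e'.
  - move=> k [f g] x [[f' [/= e ->]]|[/= e ->]].
      by rewrite uover e.
    by rewrite e VE; apply: (svalP (v k f)).
have [k f g|w [Rw pw]] := prism_lift Kp plR.
  split=> [[x [[f' [/= <- _]]|[/= -> _]]]|[bf|->]].
  - by left; apply: (svalP f').
  - by right.
  - exists ((u k (exist _ f bf) : path_space X k) k (did k, g)).
    by left; exists (exist _ f bf).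
  - by exists (sval (v k f)).1; right.
have wnat k l (a : dhom k l) f g : w k (dcomp f a, dcomp g a) = act a (w l (f, g)) :=
  shom_nat w a ((f, g) : sprod (simplex n) (simplex 1) l).
unshelve eexists.
  exists (fun k (f : simplex n k) =>
    scomp w (sprod_map (simplex_map f) (sid _)) : path_space X k).
  by move=> k l a f; apply: shomP => j [b g] /=; rewrite dcompA.
split=> k f.
  apply: shomP => j [a g] /=; rewrite (path_at (u k f)) -unat.
  by apply: Rw; left; exists (act a f).
apply: spullback_inj => /=; first by rewrite dcomp1r; apply: Rw; right.
by apply: shomP => j [a g] /=; rewrite pw VE vnat /= dcomp1r.
Qed.

(** Covering homotopy extension: the homotopy v in Y is lifted with the start f
    and, on the simplicial subset D of A, with the values H.  By adjunction
    this is an extension problem for A -> X^I over X x_Y Y^I. *)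
Lemma homotopy_extension_lifting (A X Y : sset) (p : shom X Y)
    (D : forall k, A k -> Prop) (H : forall k, A k -> dhom k 1 -> X k)
    (f : shom A X) (v : shom (sprod A (simplex 1)) Y) :
  Kan_fibration p ->
  (forall k l (a : dhom k l) x, D l x -> D k (act a x)) ->
  (forall k l (a : dhom k l) x g, D l x ->
     H k (act a x) (dcomp g a) = act a (H l x g)) ->
  (forall k x, D k x -> H k x (dconst k ord0) = f k x) ->
  (forall k x g, D k x -> p k (H k x g) = v k (x, g)) ->
  (forall k x, p k (f k x) = v k (x, dconst k ord0)) ->
  exists w : shom (sprod A (simplex 1)) X,
    [/\ forall k x g, D k x -> w k (x, g) = H k x g,
        forall k x, w k (x, dconst k ord0) = f k x &
        forall k z, p k (w k z) = v k z].
Proof.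
move=> Kp Da Ha Hf Hv fv.
have vnat k l (a : dhom k l) x (g : dhom l 1) :
    v k (act a x, dcomp g a) = act a (v l (x, g)) :=
  shom_nat v a ((x, g) : sprod A (simplex 1) l).
have [V VE] : exists V : shom A (path_space Y),
    forall k x j (a : dhom j k) (g : dhom j 1),
      (V k x : path_space Y k) j (a, g) = v j (act a x, g).
  unshelve eexists.
    exists (fun k x =>
      scomp v (sprod_map (classify x) (sid _)) : path_space Y k).
    by move=> k l a x; apply: shomP => j [b g] /=; rewrite act_comp.
  by [].
have fV k x : p k (f k x) = path_start Y k (V k x).
  by rewrite fv /= VE act_id.
pose R k (x : A k) (h : path_space X k) := D k x /\
  forall j (a : dhom j k) (g : dhom j 1), h j (a, g) = H j (act a x) g.
have plR : partial_lift (path_gap p) (spullback_pair fV) R.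
  split.
  - move=> k l a x h [Dx hE]; split; first exact: Da.
    by move=> j b g /=; rewrite hE act_comp.
  - move=> k x h h' [Dx hE] [_ hE'].
    by apply: shomP => j [a g]; rewrite hE hE'.
  - move=> k x h [Dx hE]; apply: spullback_inj.
      by rewrite /= hE act_id Hf.
    by apply: shomP => j [a g] /=; rewrite hE VE Hv //; apply: Da.
have [W [RW gW]] := trivial_fibration_extends (path_gap_trivial Kp) plR.
have [w wE] : exists w : shom (sprod A (simplex 1)) X, forall k x (g : dhom k 1),
    w k (x, g) = (W k x : path_space X k) k (did k, g).
  unshelve eexists.
    exists (fun k z => (W k z.1 : path_space X k) k (did k, z.2)).
    move=> k l a [x g]; rewrite [LHS]/= (shom_nat W) -(shom_nat (W l x : shom _ _)) /=.
    by rewrite dcomp1r dcomp1l.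
  by [].
exists w; split.
- move=> k x g Dx; rewrite wE.
  unshelve epose (h := _ : path_space X k).
    exists (fun j (z : sprod (simplex k) (simplex 1) j) =>
      H j (act (z.1 : dhom j k) x) z.2).
    move=> j l b [a c] /=; rewrite act_comp; apply: Ha; exact: Da.
  have -> : W k x = h by apply: RW; split.
  by rewrite /= act_id.
- by move=> k x; rewrite wE; have := congr1 (fun z => (sval z).1) (gW k x).
- move=> k [x g]; rewrite wE.
  have := congr1 (fun z => ((sval z).2 : path_space Y k) k (did k, g)) (gW k x).
  by rewrite /= VE act_id.
Qed.

(** * Homotopies and equivalences over a base *)

Definition fibre_homotopy (A E D : sset) (p : shom E D) (f g : shom A E) : Prop :=
  exists h : shom (sprod A (simplex 1)) E, forall k (x : A k),
    [/\ h k (x, dconst k ord0) = f k x, h k (x, dconst k ord_max) = g k x &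
        forall t, p k (h k (x, t)) = p k (f k x)].

Lemma fibre_homotopy_weaken (A E D : sset) (p : shom E D) (f g : shom A E) :
  fibre_homotopy p f g -> shomotopy f g.
Proof. by case=> h hE; exists h => k x; case: (hE k x). Qed.

Lemma homotopy_lifting (A E D : sset) (p : shom E D) (f : shom A E)
    (v : shom (sprod A (simplex 1)) D) :
  Kan_fibration p -> (forall k x, p k (f k x) = v k (x, dconst k ord0)) ->
  exists w : shom (sprod A (simplex 1)) E,
    (forall k x, w k (x, dconst k ord0) = f k x) /\
    (forall k z, p k (w k z) = v k z).
Proof.
move=> Kp fv.
have [|||||w [_ w0 wv]] := @homotopy_extension_lifting A E D p
  (fun _ _ => False) (fun k x _ => f k x) f v Kp => //.
by exists w.
Qed.

(** Two homotopies with the same start and the same image in D have ends that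
    are homotopic over D.  They form two opposite sides of a square times A,
    the constant homotopy at the common start is the third side, and a lift of
    the square that does not depend on the new coordinate downstairs has the
    required homotopy as its fourth side. *)
Lemma homotopies_with_same_start (A E D : sset) (p : shom E D)
    (a b : shom (sprod A (simplex 1)) E) (f g : shom A E) :
  Kan_fibration p ->
  (forall k z, p k (a k z) = p k (b k z)) ->
  (forall k x, a k (x, dconst k ord0) = b k (x, dconst k ord0)) ->
  (forall k x, a k (x, dconst k ord_max) = f k x) ->
  (forall k x, b k (x, dconst k ord_max) = g k x) ->
  fibre_homotopy p f g.
Proof.
move=> Kp pab ab0 af bg.
have anat k l (c : dhom k l) x (t : dhom l 1) :
    a k (act c x, dcomp t c) = act c (a l (x, t)) :=
  shom_nat a c ((x, t) : sprod A (simplex 1) l).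
have bnat k l (c : dhom k l) x (t : dhom l 1) :
    b k (act c x, dcomp t c) = act c (b l (x, t)) :=
  shom_nat b c ((x, t) : sprod A (simplex 1) l).
have const_comp k l (c : dhom k l) (i : 'I_2) : dcomp (dconst l i) c = dconst k i.
  exact: dhomP.
pose AI := sprod A (simplex 1).
have [fs fsE] : exists fs : shom AI E,
    forall k x u, fs k (x, u) = a k (x, dconst k ord0).
  unshelve eexists.
    exists (fun k (z : AI k) => a k (z.1, dconst k ord0)).
    by move=> k l c [x u] /=; rewrite -anat const_comp.
  by [].
have [v vE] : exists v : shom (sprod AI (simplex 1)) D,
    forall k x u t, v k ((x, u), t) = p k (a k (x, t)).
  unshelve eexists.
    exists (fun k (z : sprod AI (simplex 1) k) => p k (a k (z.1.1, z.2))).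
    by move=> k l c [[x u] t] /=; rewrite anat shom_nat.
  by [].
(* The second coordinate of AI is the new one; the homotopy to be lifted runs in
   the first one, and is prescribed over both ends of AI. *)
pose Dm k (z : AI k) := z.2 = dconst k ord0 \/ z.2 = dconst k ord_max.
pose H k (z : AI k) (t : dhom k 1) :=
  if (z.2 : dhom k 1) ord0 == ord0 then a k (z.1, t) else b k (z.1, t).
have [|||||w [wH w0 wv]] := @homotopy_extension_lifting AI E D p Dm H fs v Kp.
- by move=> k l c [x u] [/= -> | /= ->]; [left|right] => /=; rewrite const_comp.
- move=> k l c [x u] t; rewrite /H => -[/= -> | /= ->] /=.
    exact: anat.
  exact: bnat.
- by move=> k [x u] _; rewrite /H fsE -ab0; case: ifP.
- by move=> k [x u] t _; rewrite /H vE; case: ifP; rewrite ?pab.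
- by move=> k [x u]; rewrite fsE vE.
have wnat k l (c : dhom k l) x (u t : dhom l 1) :
    w k ((act c x, dcomp u c), dcomp t c) = act c (w l ((x, u), t)) :=
  shom_nat w c (((x, u), t) : sprod AI (simplex 1) l).
unshelve eexists.
  exists (fun k (z : sprod A (simplex 1) k) => w k (z, dconst k ord_max)).
  by move=> k l c [x u]; rewrite -wnat const_comp.
move=> k x /=; split.
- by rewrite wH /H //= ?af //; left.
- by rewrite wH /H //= ?bg //; right.
- by move=> t; rewrite wv vE af.
Qed.

Lemma shomotopy_ends (A E : sset) (f g : shom A E) : shomotopy f g ->
  exists h : shom (sprod A (simplex 1)) E,
    (forall k x, h k (x, dconst k ord0) = f k x) /\
    (forall k x, h k (x, dconst k ord_max) = g k x).
Proof. by case=> h hE; exists h; split=> k x; case: (hE k x). Qed.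

Lemma shomotopy_refl (A E : sset) (f : shom A E) : shomotopy f f.
Proof.
unshelve eexists; first exists (fun k (z : sprod A (simplex 1) k) => f k z.1).
  by move=> k l c [x u] /=; rewrite shom_nat.
by [].
Qed.

Lemma point_unique k (x y : simplex 0 k) : x = y.
Proof. by apply: dhomP => i; rewrite !ord1. Qed.

(** The case D = Delta[0] of the previous construction; together with
    reflexivity it makes homotopy into a Kan complex an equivalence
    relation. *)
Lemma shomotopy_euclid (A K : sset) (f g h : shom A K) : Kan_complex K ->
  shomotopy f g -> shomotopy f h -> shomotopy g h.
Proof.
move=> KK /shomotopy_ends[a [a0 a1]] /shomotopy_ends[b [b0 b1]].
apply: (@fibre_homotopy_weaken _ _ _ (to_point K)).
apply: (homotopies_with_same_start KK _ _ a1 b1) => k z; first exact: point_unique.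
by rewrite a0 b0.
Qed.

Lemma homotopic_Kan (A K : sset) (f g : shom A K) : Kan_complex K ->
  homotopic f g -> shomotopy f g.
Proof.
move=> KK; have sym (f' g' : shom A K) : shomotopy f' g' -> shomotopy g' f'.
  by move=> fg; apply: (shomotopy_euclid KK fg) (shomotopy_refl _).
elim=> {f g} [//|f|f g _ /sym//|f g h _ /sym gf _ gh].
  exact: shomotopy_refl.
exact: shomotopy_euclid gf gh.
Qed.

Lemma scompA (X Y Z T : sset) (h : shom Z T) (g : shom Y Z) (f : shom X Y) :
  scomp h (scomp g f) = scomp (scomp h g) f.
Proof. exact: shomP. Qed.

Lemma scomp1r (X Y : sset) (f : shom X Y) : scomp f (sid X) = f.
Proof. exact: shomP. Qed.

Lemma scomp1l (X Y : sset) (f : shom X Y) : scomp (sid Y) f = f.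
Proof. exact: shomP. Qed.

Lemma homotopic_sym (X Y : sset) (f g : shom X Y) :
  homotopic f g -> homotopic g f.
Proof. exact: rst_sym. Qed.

Lemma homotopic_trans (X Y : sset) (f g h : shom X Y) :
  homotopic f g -> homotopic g h -> homotopic f h.
Proof. exact: rst_trans. Qed.

Lemma homotopic_pre (X Y Z : sset) (f g : shom Y Z) (k : shom X Y) :
  homotopic f g -> homotopic (scomp f k) (scomp g k).
Proof.
elim=> {f g} [f g [h hE]|f|f g _|f g h _ fg _].
- apply: rst_step; exists (scomp h (sprod_map k (sid _))) => n x.
  exact: (hE n (k n x)).
- exact: rst_refl.
- exact: rst_sym.
- exact: rst_trans.
Qed.

Lemma homotopic_post (X Y Z : sset) (f g : shom X Y) (k : shom Y Z) :
  homotopic f g -> homotopic (scomp k f) (scomp k g).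
Proof.
elim=> {f g} [f g [h hE]|f|f g _|f g h _ fg _].
- apply: rst_step; exists (scomp k h) => n x /=.
  by have [-> ->] := hE n x.
- exact: rst_refl.
- exact: rst_sym.
- exact: rst_trans.
Qed.

Lemma Kan_equivalence_comp (X Y Z : sset) (f : shom X Y) (g : shom Y Z) :
  Kan_equivalence f -> Kan_equivalence g -> Kan_equivalence (scomp g f).
Proof.
move=> Ef Eg K KK; have [fi fs] := Ef K KK; have [gi gs] := Eg K KK.
split=> [h k|h]; first by rewrite !scompA => /fi/gi.
have [h' h'f] := fs h; have [h'' h''g] := gs h'; exists h''.
by rewrite scompA; apply: homotopic_trans h'f; apply: homotopic_pre.
Qed.

Lemma Kan_equivalence_cancel (X Y Z : sset) (f : shom X Y) (g : shom Y Z) :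
  Kan_equivalence (scomp g f) -> Kan_equivalence g -> Kan_equivalence f.
Proof.
move=> Egf Eg K KK; have [gfi gfs] := Egf K KK; have [gi gs] := Eg K KK.
split=> [h k hk|h]; last first.
  by have [h' h'gf] := gfs h; exists (scomp h' g); rewrite -scompA.
have [h' h'g] := gs h; have [k' k'g] := gs k.
apply: homotopic_trans (homotopic_sym h'g) (homotopic_trans _ k'g).
apply: homotopic_pre; apply: gfi; rewrite !scompA.
apply: homotopic_trans (homotopic_pre f h'g) (homotopic_trans hk _).
exact/homotopic_sym/homotopic_pre.
Qed.

(** The maps f and h are both inverse to g up to homotopy, so f g ~ 1 and
    g h ~ 1 already imply g f ~ 1. *)
Lemma Kan_equivalence_of_inverses (X Y : sset) (f : shom X Y) (g : shom Y X)
    (h : shom X Y) :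
  homotopic (scomp f g) (sid Y) -> homotopic (scomp g h) (sid X) ->
  Kan_equivalence f.
Proof.
move=> fg gh K KK.
have gf : homotopic (scomp g f) (sid X).
  have e1 := homotopic_post (scomp g f) (homotopic_sym gh).
  have e2 := homotopic_pre h (homotopic_post g fg).
  rewrite scomp1r in e1; rewrite scomp1r scompA -(scompA (scomp g f)) in e2.
  exact: homotopic_trans e1 (homotopic_trans e2 gh).
split=> [k l kl|k].
  have := homotopic_pre g kl; rewrite -!scompA => kl'.
  rewrite -(scomp1r k) -(scomp1r l).
  apply: homotopic_trans (homotopic_post k (homotopic_sym fg)) (homotopic_trans kl' _).
  exact: homotopic_post.
by exists (scomp k g); have := homotopic_post k gf; rewrite scomp1r scompA.
Qed.

(** Bijectivity of [Y, K] -> [X, K] for K = X gives g, and for K = Y it gives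
    f g ~ 1 from f g f ~ f. *)
Lemma Kan_equivalence_inverse (X Y : sset) (f : shom X Y) :
  Kan_complex X -> Kan_complex Y -> Kan_equivalence f ->
  exists g : shom Y X, shomotopy (scomp f g) (sid Y) /\ shomotopy (scomp g f) (sid X).
Proof.
move=> KX KY Ef; have [_ /(_ (sid X)) [g gf]] := Ef X KX.
exists g; split; last exact: homotopic_Kan.
apply: homotopic_Kan => //; have [fi _] := Ef Y KY; apply: fi.
by have := homotopic_post f gf; rewrite scomp1r scomp1l scompA.
Qed.

(** The main step of Dold's theorem.  Let K be a homotopy from h to the
    identity, and lift p K to a homotopy L that starts at the identity; its end
    k lies over D.  Then h L and K both start at h and have the same image
    p K, so their ends h k and 1 are homotopic over D. *)
Lemma right_inverse_of_self_map_over (E D : sset) (p : shom E D) (h : shom E E) :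
  Kan_fibration p -> (forall k x, p k (h k x) = p k x) ->
  shomotopy h (sid E) ->
  exists k : shom E E, (forall n x, p n (k n x) = p n x) /\
    fibre_homotopy p (scomp h k) (sid E).
Proof.
move=> Kp ph /shomotopy_ends[K [K0 K1]].
have [|L [L0 pL]] := @homotopy_lifting E E D p (sid E) (scomp p K) Kp.
  by move=> k x; rewrite /= K0 ph.
unshelve eexists.
  exists (fun n x => L n (x, dconst n ord_max)) => m n c x.
  by rewrite -shom_nat /=; congr (L _ (_, _)); apply: dhomP.
split=> [n x|]; first by rewrite /= pL /= K1.
apply: (@homotopies_with_same_start _ _ _ _ (scomp h L) K) => //.
- by move=> k z; rewrite /= ph pL.
- by move=> k x; rewrite /= L0 K0.
Qed.

(** First g is deformed to a map over D, by lifting the image in D of the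
    homotopy from w g to the identity; then w g is a self-map of E' over D that
    is homotopic to the identity. *)
Lemma right_homotopy_inverse_over (E E' D : sset) (r : shom E D) (q : shom E' D)
    (w : shom E E') (g : shom E' E) :
  Kan_fibration r -> Kan_fibration q -> Kan_complex E' ->
  (forall n x, q n (w n x) = r n x) -> shomotopy (scomp w g) (sid E') ->
  exists g' : shom E' E, (forall n x, r n (g' n x) = q n x) /\
    fibre_homotopy q (scomp w g') (sid E').
Proof.
move=> Kr Kq KE' qw wg; have [H [H0 H1]] := shomotopy_ends wg.
have [|L [L0 rL]] := @homotopy_lifting E' E D r g (scomp q H) Kr.
  by move=> k x; rewrite /= H0 /= qw.
have [g1 g1E] : exists g1 : shom E' E,
    forall n x, g1 n x = L n (x, dconst n ord_max).
  unshelve eexists.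
    exists (fun n x => L n (x, dconst n ord_max)) => m n c x.
    by rewrite -shom_nat /=; congr (L _ (_, _)); apply: dhomP.
  by [].
have rg1 n x : r n (g1 n x) = q n x by rewrite g1E rL /= H1.
have gg1 : shomotopy g g1 by exists L => n x; rewrite L0 g1E.
have wg1 : shomotopy (scomp w g1) (sid E').
  apply: homotopic_Kan => //; apply: homotopic_trans (rst_step _ _ _ _ wg).
  by apply/homotopic_post/homotopic_sym/rst_step.
have [|k [qk hk]] := right_inverse_of_self_map_over Kq _ wg1.
  by move=> n x; rewrite /= qw.
by exists (scomp g1 k); split; [move=> n x; rewrite /= rg1 qk|rewrite scompA].
Qed.

(** Here h need not be w: g has its own right inverse over D, found in the same
    way as g itself.  This form suffices for [Kan_equivalence_of_inverses],
    and it can be pulled back. *)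
Lemma homotopy_inverses_over (E E' D : sset) (r : shom E D) (q : shom E' D)
    (w : shom E E') :
  Kan_fibration r -> Kan_fibration q -> Kan_complex E -> Kan_complex E' ->
  (forall n x, q n (w n x) = r n x) -> Kan_equivalence w ->
  exists (g : shom E' E) (h : shom E E'),
    [/\ forall n x, r n (g n x) = q n x, forall n x, q n (h n x) = r n x,
        fibre_homotopy q (scomp w g) (sid E') &
        fibre_homotopy r (scomp g h) (sid E)].
Proof.
move=> Kr Kq KE KE' qw Ew.
have [f [wf fw]] := Kan_equivalence_inverse KE KE' Ew.
have [g [rg wg]] := right_homotopy_inverse_over Kr Kq KE' qw wf.
(* w g ~ 1 and f w ~ 1 give g ~ f w g ~ f. *)
have fg : homotopic g f.
  have /(homotopic_post f) := rst_step _ _ _ _ (fibre_homotopy_weaken wg).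
  rewrite scomp1r; apply: homotopic_trans.
  have := homotopic_pre g (homotopic_sym (rst_step _ _ _ _ fw)).
  by rewrite scomp1l scompA.
have gw : shomotopy (scomp g w) (sid E).
  apply: homotopic_Kan => //; apply: homotopic_trans (homotopic_pre w fg) _.
  exact: rst_step.
have [h [qh gh]] := right_homotopy_inverse_over Kq Kr KE rg gw.
by exists g, h.
Qed.

Definition base_change (E E' C D : sset) (r : shom E D) (q : shom E' D)
    (c : shom C D) (f : shom E E') (e : forall n x, q n (f n x) = r n x) :
  shom (spullback r c) (spullback q c).
Proof.
exists (fun n z => exist (fun y : E' n * C n => q n y.1 = c n y.2)
  (f n (sval z).1, (sval z).2) (etrans (e n _) (svalP z))).
by move=> m n a z; apply: spullback_inj; rewrite /= ?shom_nat.
Defined.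

Lemma base_change_homotopy (E E' C D : sset) (r : shom E D) (q : shom E' D)
    (c : shom C D) (f : shom E E') (g : shom E' E) ef eg :
  fibre_homotopy q (scomp f g) (sid E') ->
  homotopic (scomp (@base_change E E' C D r q c f ef)
                   (@base_change E' E C D q r c g eg)) (sid (spullback q c)).
Proof.
case=> h hE; apply: rst_step.
have qh n (z : sprod (spullback q c) (simplex 1) n) :
    q n (h n ((sval z.1).1, z.2)) = c n (sval z.1).2.
  have [_ _ ->] := hE n (sval z.1).1.
  by rewrite /= ef eg; exact: (svalP z.1).
unshelve eexists.
  exists (fun n z => exist (fun y : E' n * C n => q n y.1 = c n y.2)
    (h n ((sval z.1).1, z.2), (sval z.1).2) (qh n z)).
  by move=> m n a [z t]; apply: spullback_inj; rewrite //= -shom_nat.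
move=> n z; have [h0 h1 _] := hE n (sval z).1.
by split; apply: spullback_inj; rewrite //= ?h0 ?h1.
Qed.

Lemma Kan_equivalence_base_change (E E' C D : sset) (r : shom E D)
    (q : shom E' D) (c : shom C D) (w : shom E E') ew :
  Kan_fibration r -> Kan_fibration q -> Kan_complex E -> Kan_complex E' ->
  Kan_equivalence w -> Kan_equivalence (@base_change E E' C D r q c w ew).
Proof.
move=> Kr Kq KE KE' Ew.
have [g [h [rg qh wg gh]]] := homotopy_inverses_over Kr Kq KE KE' ew Ew.
apply: (@Kan_equivalence_of_inverses _ _ _ (base_change c rg) (base_change c qh));
  exact: base_change_homotopy.
Qed.

(** Compare p, as a map over D, with the identity fibration of D. *)
Lemma fibration_section (E D : sset) (p : shom E D) :
  Kan_fibration p -> Kan_complex E -> Kan_complex D -> Kan_equivalence p ->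
  exists s : shom D E, (forall n x, p n (s n x) = x) /\
    fibre_homotopy p (scomp s p) (sid E).
Proof.
move=> Kp KE KD Ep.
have KidD : Kan_fibration (sid D).
  by move=> n i n0 u v uv; exists v; split=> // k x; rewrite -uv.
have [//|g [h [pg hp _ gh]]] :=
  @homotopy_inverses_over E D D p (sid D) p Kp KidD KE KD _ Ep.
exists g; split=> [n x|]; first exact: pg.
have e : h = p by apply: shomP => n x; rewrite -hp.
by rewrite e in gh.
Qed.

Lemma Kan_complex_total (E D : sset) (p : shom E D) :
  Kan_fibration p -> Kan_complex D -> Kan_complex E.
Proof.
move=> Kp KD n i n0 u v uv.
have [|w [wu _]] := KD n i n0 (scomp p u) (to_point _).
  by move=> *; exact: point_unique.
have [|w' [w'u _]] := Kp n i n0 u w; first by move=> k x; rewrite wu.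
by exists w'; split=> // k x; exact: point_unique.
Qed.

Lemma Kan_complex_prod (X Y : sset) :
  Kan_complex X -> Kan_complex Y -> Kan_complex (sprod X Y).
Proof.
move=> KX KY n i n0 u v uv.
pose u1 : shom (horn i) X :=
  scomp (@SHom (sprod X Y) X (fun _ z => z.1) (fun _ _ _ _ => erefl)) u.
pose u2 : shom (horn i) Y :=
  scomp (@SHom (sprod X Y) Y (fun _ z => z.2) (fun _ _ _ _ => erefl)) u.
have [|w1 [w1u _]] := KX n i n0 u1 (to_point _); first by move=> *; exact: point_unique.
have [|w2 [w2u _]] := KY n i n0 u2 (to_point _); first by move=> *; exact: point_unique.
unshelve eexists; first exists (fun k x => (w1 k x, w2 k x) : sprod X Y k).
  by move=> k l a x; rewrite /= !shom_nat.
split=> k x; last exact: point_unique.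
by rewrite /= w1u w2u /= -surjective_pairing.
Qed.

(** * Reedy fibrant simplicial spaces, one row at a time *)

(** The simplicial set k |-> (W_k)_m, which Reedy fibrancy makes accessible by
    lifting in the direction of k. *)
Definition row (W : sspace) (m : nat) : sset.
Proof.
exists (fun k => W k m) (fun k l f => sp_act f m).
- by move=> n x; apply: sp_act_id.
- by move=> k l n g f x; apply: sp_act_comp.
Defined.

Lemma Map_at (A : sset) (W : sspace) l (g : Map (disc_sp A) W l) k j (a : A k)
    (c : dhom j l) :
  (g : sphom _ _) k j (a, c) = act c ((g : sphom _ _) k l (a, did l)).
Proof. by rewrite -shom_nat /= dcomp1l. Qed.

(** With [row_of_Map], the identification of Map(A, W)_m with the maps
    from A to the m-th row of W, for A constant in the space direction. *)
Definition Map_of_row (A : sset) (W : sspace) m (f : shom A (row W m)) :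
  Map (disc_sp A) W m.
Proof.
unshelve eexists.
  move=> k; exists (fun j (z : spprod (disc_sp A) (const_sp (simplex m)) k j) =>
    act (z.2 : dhom j m) (f k z.1)).
  by move=> i j b [a c] /=; rewrite act_comp.
by move=> k l b j [a c] /=; rewrite (shom_nat f) /= shom_nat.
Defined.

Definition row_of_Map (A : sset) (W : sspace) m (g : Map (disc_sp A) W m) :
  shom A (row W m).
Proof.
exists (fun k a => (g : sphom _ _) k m (a, did m)) => k l b a.
exact: (sphom_nat g b (a, did m)).
Defined.

Lemma Map_ext (A : sset) (W : sspace) l (g h : Map (disc_sp A) W l) :
  (forall k (a : A k), row_of_Map g k a = row_of_Map h k a) -> g = h.
Proof.
move=> gh; apply: sphomP => k j [a c]; rewrite (Map_at g) (Map_at h).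
by have /= -> := gh k a.
Qed.

Lemma row_of_Map_act (A : sset) (W : sspace) l m (c : dhom l m)
    (g : Map (disc_sp A) W m) k (a : A k) :
  row_of_Map (act c g) k a = act c (row_of_Map g k a : W k m).
Proof. by rewrite /= -(Map_at g) dcomp1r. Qed.

Lemma Map_F_ext (W : sspace) n l (g h : Map (F n) W l) :
  (g : sphom _ _) n l (did n, did l) = (h : sphom _ _) n l (did n, did l) -> g = h.
Proof.
move=> gh; apply: Map_ext => k f.
have := sphom_nat g f (did n, did l); rewrite /= dcomp1l => ->.
have := sphom_nat h f (did n, did l); rewrite /= dcomp1l => ->.
by rewrite gh.
Qed.

Definition horn_maps (W : sspace) m (i : 'I_m.+1) : sset.
Proof.
exists (fun k => shom (horn i) (W k)) (fun k l f h => scomp (sp_act f) h).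
- by move=> n x; apply: shomP => k b /=; apply: sp_act_id.
- by move=> k l n g f x; apply: shomP => j b /=; apply: sp_act_comp.
Defined.

Definition horn_restriction (W : sspace) m (i : 'I_m.+1) :
  shom (row W m) (horn_maps W i).
Proof.
exists (fun k (x : row W m k) =>
  scomp (classify (x : W k m)) (horn_incl i) : horn_maps W i k).
by move=> k l f x; apply: shomP => j b /=; rewrite shom_nat.
Defined.

(** The lifting problems of Delta[n] relative to its boundary against this map
    and those of Delta[m] relative to its horn against the n-th matching map of
    W are two readings of the same extension problem for bisimplicial maps. *)
Lemma horn_restriction_trivial (W : sspace) m (i : 'I_m.+1) :
  Reedy_fibrant W -> 0 < m -> trivial_fibration (horn_restriction W i).
Proof.
move=> hW m0 n u v uv.
have vE k (f : dhom k n) l b : v k f l b = sp_act f l (v n (did n) l b).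
  by have := shom_nat v f (did n : simplex n n); rewrite /= dcomp1l => ->.
have uvE k (f : boundary n k) l (b : horn i l) :
    act (sval b) (u k f : W k m) = sp_act (sval f) l (v n (did n) l b).
  by have := congr1 (fun h : shom (horn i) (W k) => h l b) (uv k f); rewrite /= vE.
(* The map to the terminal object carries no information. *)
pose c0 : Map (F n) (F 0) m := to_F0 (spprod (F n) (const_sp (simplex m))).
have c0E : Map_post (dF n) (to_F0 W) m (Map_of_row u) = Map_pre (F 0) (dF_incl n) m c0.
  by apply: sphomP => k l x; apply: point_unique.
pose v1 : spullback (Map_post (dF n) (to_F0 W)) (Map_pre (F 0) (dF_incl n)) m :=
  exist _ (Map_of_row u, c0) c0E.
have [|w [wu wv]] := hW n m i m0 (scomp (yoneda W n) (v n (did n))) (classify v1).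
  move=> l b; apply: spullback_inj.
    by apply: Map_ext => k f; rewrite /= act_id dcomp1r uvE.
  by apply: sphomP => k j x; apply: point_unique.
pose z := (w m (did m) : sphom _ _) n m (did n, did m).
have wz l (c : dhom l m) : (w l c : sphom _ _) n l (did n, did l) = act c z.
  have := shom_nat w c (did m : simplex m m); rewrite /= dcomp1l => -> /=.
  by rewrite dcomp1r (Map_at (w m (did m))).
exists (classify (z : row W m n)); split=> k f.
  have := congr1 (fun y : spullback (Map_post (dF n) (to_F0 W))
      (Map_pre (F 0) (dF_incl n)) m =>
    row_of_Map ((sval y).1 : Map (dF n) W m) k f) (wv m (did m)).
  rewrite /= dcomp1l act_id => <-.
  have := sphom_nat (w m (did m)) (sval f) (did n, did m).
  by rewrite /= dcomp1l => ->.
apply: shomP => l b; rewrite vE /= -shom_nat; congr (sp_act _ _ _).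
rewrite -wz; have -> := wu l b.
by rewrite /= act_id sp_act_id.
Qed.

(** The horn restriction lifts against the inclusion into Delta[N] of the
    simplicial subset on which R prescribes values; by the Yoneda lemma the
    lift is a simplex of W_N. *)
Lemma simplex_filler (W : sspace) N m (i : 'I_m.+1) (u : shom (horn i) (W N))
    (R : forall k, dhom k N -> W k m -> Prop) :
  Reedy_fibrant W -> 0 < m ->
  (forall k l (a : dhom k l) f x, R l f x -> R k (dcomp f a) (sp_act a m x)) ->
  (forall k f x y, R k f x -> R k f y -> x = y) ->
  (forall k f x l (b : horn i l), R k f x ->
     act (sval b) x = sp_act f l (u l b)) ->
  exists z : W N m, (forall k f x, R k f x -> sp_act f m z = x) /\
    (forall l b, act (sval b) z = u l b).
Proof.
move=> hW m0 Ra Rf Ru.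
pose v : shom (simplex N) (horn_maps W i) := @classify (horn_maps W i) N u.
have plR : @partial_lift (simplex N) _ _ (horn_restriction W i) v R.
  split=> [|//|k f x Rx]; first exact: Ra.
  by apply: shomP => l b; rewrite /= (Ru _ _ _ _ _ Rx).
have [w [Rw rw]] := trivial_fibration_extends (horn_restriction_trivial hW m0) plR.
exists (w N (did N)); split=> [k f x /Rw <-|l b].
  by have := shom_nat w f (did N : simplex N N); rewrite /= dcomp1l => ->.
have := congr1 (fun h : shom (horn i) (W N) => h l b) (rw N (did N)).
by rewrite /= sp_act_id.
Qed.

Lemma Map_Kan_complex (W : sspace) (A : sset) :
  Reedy_fibrant W -> Kan_complex (Map (disc_sp A) W).
Proof.
move=> hW m i m0 u v0 _.
have ext l (b : horn i l) k (a : A k) j (c : dhom j l) :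
    (u j (act c b) : sphom _ _) k j (a, did j) =
    act c ((u l b : sphom _ _) k l (a, did l)).
  by rewrite shom_nat /= -Map_at dcomp1r.
have [v vE] : exists v : shom A (horn_maps W i), forall k (a : A k) l b,
    (v k a : shom (horn i) (W k)) l b = (u l b : sphom _ _) k l (a, did l).
  unshelve eexists.
    unshelve eexists.
      move=> k a; exists (fun l b => (u l b : sphom _ _) k l (a, did l)).
      by move=> j l c b; apply: ext.
    by move=> k l f a; apply: shomP => j b /=; exact: (sphom_nat (u j b) f (a, did j)).
  by [].
have [|w [_ rw]] := @trivial_fibration_extends A _ _ (horn_restriction W i) v
  (fun _ _ _ => False) (horn_restriction_trivial hW m0); first by split.
exists (classify (Map_of_row w)); split=> l b; last exact: point_unique.
apply: Map_ext => k a; rewrite /= dcomp1r.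
have := congr1 (fun h : shom (horn i) (W k) => h l b) (rw k a).
by rewrite /= vE.
Qed.

Lemma level_Kan_complex (W : sspace) n : Reedy_fibrant W -> Kan_complex (W n).
Proof.
move=> hW m i m0 u v0 _.
have [|||z [_ zu]] := @simplex_filler W n m i u (fun _ _ _ => False) hW m0 => //.
by exists (classify z); split=> k x; [apply: zu|apply: point_unique].
Qed.

Lemma Segal_map_fibration (W : sspace) n :
  Reedy_fibrant W -> Kan_fibration (Segal_map W n).
Proof.
move=> hW m i m0 u v uv.
pose R k (f : dhom k n) (x : W k m) := exists pf : in_spine f,
  x = (v m (did m) : sphom _ _) k m
        (exist _ f pf : subsimplex (@spine_stable n) k, did m).
have [|||z [zR zu]] := @simplex_filler W n m i u R hW m0.
- move=> k l a f x [pf ->]; exists (@spine_stable n _ _ a f pf).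
  have /= <- := sphom_nat (v m (did m)) a
    (exist _ f pf : subsimplex (@spine_stable n) l, did m).
  by congr (v _ _ _ _ (_, _)); apply: subsimplex_inj.
- move=> k f x y [pf ->] [pf' ->].
  by rewrite (Prop_irrelevance pf pf').
- move=> k f x l b [pf ->]; rewrite -Map_at.
  have := congr1 (fun g : Map (G n) W l => (g : sphom _ _) k l
    (exist _ f pf : subsimplex (@spine_stable n) k, did l)) (uv l b).
  rewrite /= act_id => ->.
  have := shom_nat v (sval b) (did m : simplex m m); rewrite /= dcomp1l => ->.
  by rewrite /= dcomp1r.
exists (classify z); split=> l b; first exact: zu.
apply: Map_ext => k [f pf]; rewrite /= act_id shom_nat (zR k f _ (ex_intro _ pf erefl)).
rewrite -Map_at; have := shom_nat v b (did m : simplex m m).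
by rewrite /= dcomp1l => ->; rewrite /= dcomp1r.
Qed.

(** * Filling in the twisted arrow construction *)

(** Send x to the largest value of g that is at most x, or to the least value
    of g if there is none. *)
Lemma image_retraction n k (g : 'I_k.+1 -> 'I_n.+1) :
  exists e : dhom n n, (forall x, exists y, e x = g y) /\ forall y, e (g y) = g y.
Proof.
pose y0 := [arg min_(y < ord0) g y].
have y0min y : g y0 <= g y by rewrite /y0; case: arg_minnP => // z _; apply.
pose top (x : 'I_n.+1) := [arg max_(y > y0 | g y <= maxn x (g y0)) g y].
have topP x : g (top x) <= maxn x (g y0) /\
    forall y, g y <= maxn x (g y0) -> g y <= g (top x).
  by rewrite /top; case: arg_maxnP => //; rewrite leq_maxr.
have emono (x x' : 'I_n.+1) : x <= x' -> g (top x) <= g (top x').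
  move=> xx'; have [h _] := topP x; have [_] := topP x'; apply.
  by apply: leq_trans h _; rewrite geq_max leq_maxr andbT leq_max xx'.
exists (DHom emono); split=> [x|y] /=; first by exists (top x).
have my : maxn (g y) (g y0) = g y by apply/maxn_idPl/y0min.
have [] := topP (g y); rewrite my => h1 h2.
by apply: val_inj; apply/eqP; rewrite eqn_leq h1 h2.
Qed.

(** The vertex of [n] of which a vertex of [n]^op * [n] is a copy.  In the first
    factor the reversal is that of the identification of [n]^op with [n]. *)
Definition arrow_index n (y : 'I_(n.+1 + n.+1)) : 'I_n.+1 :=
  match split y with inl a => rev_ord a | inr b => b end.

Lemma arrow_index_left n (a : 'I_n.+1) : arrow_index (lshift n.+1 a) = rev_ord a.
Proof. by rewrite /arrow_index (unsplitK (inl a : 'I_n.+1 + 'I_n.+1)). Qed.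

Lemma arrow_index_right n (b : 'I_n.+1) : arrow_index (rshift n.+1 b) = b.
Proof. by rewrite /arrow_index (unsplitK (inr b : 'I_n.+1 + 'I_n.+1)). Qed.

Lemma Qmap_fixP n k (e : dhom n n) (f : dhom k (n + n.+1)) :
  dcomp (Qmap e) f = f <->
  forall x, e (@arrow_index n (f x)) = @arrow_index n (f x).
Proof.
have fix1 (y : 'I_(n.+1 + n.+1)) :
    djoin_fun (dop e) e y = y <-> e (arrow_index y) = arrow_index y.
  rewrite -{2 3 4}(splitK y) /djoin_fun; case: (split y) => a /=.
    rewrite arrow_index_left; split=> [/lshift_inj {2}<-|->]; by rewrite !rev_ordK.
  by rewrite arrow_index_right; split=> [/rshift_inj|->].
split=> [ff x|h]; last by apply: dhomP => x; apply/fix1.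
have := congr1 (fun g : dhom k (n + n.+1) => g x) ff; exact: (fix1 (f x)).1.
Qed.

Lemma Qinl_inj n k (f g : dhom k n) :
  dcomp (Qinl n) f = dcomp (Qinl n) g -> f = g.
Proof.
move=> e; apply: dhomP => x; apply: (@lshift_inj n.+1 n.+1).
by have := congr1 (fun h : dhom k (n + n.+1) => h x) e.
Qed.

Lemma Qinr_inj n k (f g : dhom k n) :
  dcomp (Qinr n) f = dcomp (Qinr n) g -> f = g.
Proof.
move=> e; apply: dhomP => x; apply: (@rshift_inj n.+1 n.+1).
by have := congr1 (fun h : dhom k (n + n.+1) => h x) e.
Qed.

Lemma Qinl_neq_Qinr n k (f g : dhom k n) :
  dcomp (Qinl n) f <> dcomp (Qinr n) g.
Proof.
move=> e; have := congr1 (fun h : dhom k (n + n.+1) => val (h ord0)) e.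
by rewrite /=; have := ltn_ord (f ord0); lia.
Qed.

(** The lifting problem of the n-th matching map, read in W: the horn u is to be
    filled with the faces t of the twisted arrow construction and with source
    a and target b.  The filler is prescribed on f : [k] -> [n]^op * [n] in
    three cases: f is fixed by Q(e) for some non-surjective e, or it lands in
    the first factor, or in the second one. *)
Lemma Tw_filler (W : sspace) n m (i : 'I_m.+1)
    (u : shom (horn i) (W (n + n.+1)))
    (t : shom (boundary n) (row (Tw W) m)) (a b : W n m) :
  Reedy_fibrant W -> 0 < m ->
  (forall k (f : boundary n k),
     sp_act (Qinl k) m (t k f : W (k + k.+1) m) = sp_act (dop (sval f)) m a) ->
  (forall k (f : boundary n k),
     sp_act (Qinr k) m (t k f : W (k + k.+1) m) = sp_act (sval f) m b) ->
  (forall k (f : boundary n k) l (c : horn i l),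
     act (sval c) (t k f : W (k + k.+1) m) = sp_act (Qmap (sval f)) l (u l c)) ->
  (forall l (c : horn i l), act (sval c) a = sp_act (Qinl n) l (u l c)) ->
  (forall l (c : horn i l), act (sval c) b = sp_act (Qinr n) l (u l c)) ->
  exists z : W (n + n.+1) m,
    [/\ forall k (f : boundary n k), sp_act (Qmap (sval f)) m z = t k f,
        sp_act (Qinl n) m z = a, sp_act (Qinr n) m z = b &
        forall l (c : horn i l), act (sval c) z = u l c].
Proof.
move=> hW m0 ta tb tu au bu.
have tE k l (f : boundary n l) (g : dhom k l) (pf : in_boundary (dcomp (sval f) g)) :
    (t k (exist _ (dcomp (sval f) g) pf) : W _ m) = sp_act (Qmap g) m (t l f : W _ m).
  rewrite -[RHS](shom_nat t g f); congr (t _ _); exact: subsimplex_inj.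
pose R k (f : dhom k (n + n.+1)) (x : W k m) :=
  [\/ exists e : boundary n n, dcomp (Qmap (sval e)) f = f /\
        x = sp_act f m (t n e : W (n + n.+1) m),
      exists g, f = dcomp (Qinl n) g /\ x = sp_act g m a |
      exists g, f = dcomp (Qinr n) g /\ x = sp_act g m b].
(* The prescribed value does not depend on e: with d the retraction onto the
   indices of f, Q(e) and Q(d) fix f and e d = d, so it equals the one for d. *)
have R11 k (f : dhom k (n + n.+1)) (e e' : boundary n n) :
    dcomp (Qmap (sval e)) f = f -> dcomp (Qmap (sval e')) f = f ->
    sp_act f m (t n e : W (n + n.+1) m) = sp_act f m (t n e' : W (n + n.+1) m).
  move=> ef e'f.
  have [d [dim dfix]] := image_retraction (fun x => @arrow_index n (f x)).
  have df : dcomp (Qmap d) f = f by apply/Qmap_fixP.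
  have absorb (c : boundary n n) (pf : in_boundary d) :
      dcomp (Qmap (sval c)) f = f ->
      sp_act f m (t n c : W (n + n.+1) m) =
      sp_act f m (t n (exist _ d pf : boundary n n) : W (n + n.+1) m).
    move=> /Qmap_fixP cf; rewrite -{1}df sp_act_comp.
    have cd : dcomp (sval c) d = d.
      by apply: dhomP => x /=; have [y ->] := dim x.
    have pf' : in_boundary (dcomp (sval c) d) by rewrite cd.
    rewrite -(tE _ _ _ _ pf'); congr (sp_act f m (t n _)); exact: subsimplex_inj.
  have pd : in_boundary d.
    have <- : dcomp (sval e) d = d.
      apply: dhomP => x /=; have [y ->] := dim x.
      by move/Qmap_fixP: ef.
    by apply: boundary_stable; apply: (svalP e).
  by rewrite (absorb e pd ef) (absorb e' pd e'f).
have R12 k (e : boundary n n) (g : dhom k n) :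
    dcomp (Qmap (sval e)) (dcomp (Qinl n) g) = dcomp (Qinl n) g ->
    sp_act (dcomp (Qinl n) g) m (t n e : W (n + n.+1) m) = sp_act g m a.
  move=> ef; rewrite sp_act_comp ta -sp_act_comp.
  suff -> : dcomp (dop (sval e)) g = g by [].
  by apply: Qinl_inj; rewrite dcompA -Qinl_nat -dcompA.
have R13 k (e : boundary n n) (g : dhom k n) :
    dcomp (Qmap (sval e)) (dcomp (Qinr n) g) = dcomp (Qinr n) g ->
    sp_act (dcomp (Qinr n) g) m (t n e : W (n + n.+1) m) = sp_act g m b.
  move=> ef; rewrite sp_act_comp tb -sp_act_comp.
  suff -> : dcomp (sval e) g = g by [].
  by apply: Qinr_inj; rewrite dcompA -Qinr_nat -dcompA.
have [|||z [zR zu]] := @simplex_filler W _ m i u R hW m0.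
- move=> k l c f x [[e [ef ->]]|[g [-> ->]]|[g [-> ->]]].
  + by apply: Or31; exists e; rewrite dcompA ef -sp_act_comp.
  + by apply: Or32; exists (dcomp g c); rewrite dcompA -sp_act_comp.
  + by apply: Or33; exists (dcomp g c); rewrite dcompA -sp_act_comp.
- move=> k f x y [[e [ef ->]]|[g [fg ->]]|[g [fg ->]]]
      [[e' [ef' ->]]|[g' [fg' ->]]|[g' [fg' ->]]].
  + exact: R11.
  + by subst f; apply: R12.
  + by subst f; apply: R13.
  + by subst f; rewrite R12.
  + by rewrite (@Qinl_inj _ _ g g') // -fg.
  + by case: (@Qinl_neq_Qinr n k g g'); rewrite -fg.
  + by subst f; rewrite R13.
  + by case: (@Qinl_neq_Qinr n k g' g); rewrite -fg.
  + by rewrite (@Qinr_inj _ _ g g') // -fg.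
- move=> k f x l c [[e [ef ->]]|[g [-> ->]]|[g [-> ->]]].
  + by rewrite -shom_nat tu -sp_act_comp ef.
  + by rewrite -shom_nat au -sp_act_comp.
  + by rewrite -shom_nat bu -sp_act_comp.
exists z; split=> //.
- move=> k f.
  (* Every face is of the form e f with e a non-surjective endomorphism of [n],
     so the endomorphisms account for all faces. *)
  have [e [eim efix]] := image_retraction (sval f).
  have pe : in_boundary e.
    have /in_boundaryP[j jf] := svalP f.
    by apply/in_boundaryP; exists j => x; have [y ->] := eim x; apply: jf.
  have ef : dcomp e (sval f) = sval f by apply: dhomP => x; apply: efix.
  have pf : in_boundary (dcomp e (sval f)) by rewrite ef; apply: (svalP f).
  rewrite (zR _ (Qmap (sval f))
    (sp_act (Qmap (sval f)) m (t n (exist _ e pe : boundary n n)))).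
    rewrite -(tE _ _ (exist _ e pe : boundary n n) (sval f) pf).
    congr (t _ _); exact: subsimplex_inj.
  by apply: Or31; exists (exist _ e pe); rewrite /= -Qmap_comp ef.
- rewrite (zR _ (Qinl n) a) //.
  by apply: Or32; exists (did n); rewrite dcomp1r sp_act_id.
- rewrite (zR _ (Qinr n) b) //.
  by apply: Or33; exists (did n); rewrite dcomp1r sp_act_id.
Qed.

(** * The twisted arrow projection is a Reedy fibration *)

Lemma row_of_Map_F (W : sspace) n l (g : Map (F n) W l) k (f : dhom k n) :
  row_of_Map g k f = sp_act f l (row_of_Map g n (did n)).
Proof. by rewrite -[RHS](shom_nat (row_of_Map g)) /= dcomp1l. Qed.

Lemma Tw_proj_Reedy_fibration (W : sspace) :
  Reedy_fibrant W -> Reedy_fibration (Tw_proj W).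
Proof.
move=> hW n m i m0 u v uv.
pose X := spprod (op W) W.
pose PB := spullback (Map_post (dF n) (Tw_proj W)) (Map_pre X (dF_incl n)).
have [u1 u1E] : exists u1 : shom (horn i) (W (n + n.+1)), forall l c,
    u1 l c = row_of_Map (u l c : Map (F n) (Tw W) l) n (did n).
  unshelve eexists.
    exists (fun l c => row_of_Map (u l c : Map (F n) (Tw W) l) n (did n)).
    by move=> k l a c; rewrite shom_nat; exact: (row_of_Map_act a (u l c) (did n)).
  by [].
pose v0 : PB m := v m (did m).
pose t : shom (boundary n) (row (Tw W) m) :=
  row_of_Map ((sval v0).1 : Map (dF n) (Tw W) m).
pose ab : X n m := row_of_Map ((sval v0).2 : Map (F n) X m) n (did n).
have vE l (c : dhom l m) : v l c = act c v0.
  by have := shom_nat v c (did m : simplex m m); rewrite /= dcomp1l.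
have tab k (f : boundary n k) : Tw_proj W k m (t k f) = sp_act (sval f) m ab.
  have := congr1 (fun g : Map (dF n) X m => row_of_Map g k f) (svalP v0).
  by rewrite -(row_of_Map_F ((sval v0).2 : Map (F n) X m)).
have tu k (f : boundary n k) l (c : horn i l) :
    act (sval c) (t k f : W (k + k.+1) m) = sp_act (Qmap (sval f)) l (u1 l c).
  have := congr1 (fun y : PB l =>
    row_of_Map ((sval y).1 : Map (dF n) (Tw W) l) k f) (uv l c).
  rewrite vE u1E => e.
  apply: etrans (esym
    (row_of_Map_act (sval c) ((sval v0).1 : Map (dF n) (Tw W) m) f)) _.
  apply: etrans (esym e) _.
  exact: (row_of_Map_F (u l c : Map (F n) (Tw W) l)).
have abu l (c : horn i l) : Tw_proj W n l (u1 l c) = act (sval c) ab.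
  have := congr1 (fun y : PB l =>
    row_of_Map ((sval y).2 : Map (F n) X l) n (did n)) (uv l c).
  rewrite vE u1E => e; apply: etrans e _.
  exact: (row_of_Map_act (sval c) ((sval v0).2 : Map (F n) X m) (did n)).
have [||||z [zt za zb zu]] := @Tw_filler W n m i u1 t ab.1 ab.2 hW m0 _ _ tu.
- by move=> k f; have := congr1 fst (tab k f).
- by move=> k f; have := congr1 snd (tab k f).
- by move=> l c; have := congr1 fst (abu l c).
- by move=> l c; have := congr1 snd (abu l c).
exists (classify (yoneda (Tw W) n m z)); split=> l c.
  apply: Map_F_ext; rewrite /= Qmap_id sp_act_id dcomp1r zu u1E.
  by [].
rewrite vE; apply: spullback_inj.
  apply: Map_ext => k f.
  rewrite -[RHS]/(row_of_Map (act c ((sval v0).1 : Map (dF n) (Tw W) m)) k f).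
  rewrite row_of_Map_act.
  by rewrite /= dcomp1r (shom_nat (sp_act (Qmap (sval f)))) zt.
apply: Map_F_ext.
rewrite -[RHS]/(row_of_Map (act c ((sval v0).2 : Map (F n) X m)) n (did n)).
rewrite row_of_Map_act -/ab.
rewrite /= Qmap_id sp_act_id dcomp1r !shom_nat za zb.
by case: (ab).
Qed.

(** The case n = 0 of the filling problem, in which there are no faces t. *)
Lemma Tw_proj_fibration0 (W : sspace) :
  Reedy_fibrant W -> Kan_fibration (Tw_proj W 0).
Proof.
move=> hW m i m0 u v uv.
have no k (f : boundary 0 k) : False.
  by have /in_boundaryP[j /(_ ord0)] := svalP f; rewrite !ord1 eqxx.
have t : shom (boundary 0) (row (Tw W) m).
  by unshelve eexists; [move=> k f; case: (no k f)|move=> k l a f; case: (no l f)].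
have vE l (c : dhom l m) : v l c = act c (v m (did m)).
  by have := shom_nat v c (did m : simplex m m); rewrite /= dcomp1l.
have uv1 l (c : horn i l) := esym (etrans (uv l c) (vE l (sval c))).
have [|||||z [_ za zb zu]] :=
  @Tw_filler W 0 m i u t (v m (did m)).1 (v m (did m)).2 hW m0.
- by move=> k f; case: (no k f).
- by move=> k f; case: (no k f).
- by move=> k f; case: (no k f).
- by move=> l c; have := congr1 fst (uv1 l c).
- by move=> l c; have := congr1 snd (uv1 l c).
exists (classify (z : Tw W 0 m)); split=> l c; first exact: zu.
rewrite vE /= !shom_nat za zb.
by [].
Qed.

(** * Comparison with the spine *)

Definition spine n : sset := subsimplex (@spine_stable n).

(** The edge from the last vertex of [n]^op to the first vertex of [n], which is
    the image under Q of the vertex 0 of [n]. *)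
Definition middle n : dhom (0 + 1) (n + n.+1) := Qmap (dconst 0 (ord0 : 'I_n.+1)).

Lemma middle_val n (x : 'I_(0 + 1).+1) : middle n x = n + x :> nat.
Proof.
rewrite /= /djoin_fun; case: (@splitP 1 1 x) => j /= ->; rewrite (ord1 j) /=.
  by rewrite subSS subn0 addn0.
by rewrite addn0 addn1.
Qed.

Lemma middle_inj n k (f g : dhom k (0 + 1)) :
  dcomp (middle n) f = dcomp (middle n) g -> f = g.
Proof.
move=> e; apply: dhomP => x; apply: val_inj => /=.
have := congr1 (fun h : dhom k (n + n.+1) => val (h x)) e.
by rewrite [LHS]middle_val [RHS]middle_val => /addnI.
Qed.

Lemma middle_left n k (g : dhom k (0 + 1)) (f : dhom k n) :
  dcomp (middle n) g = dcomp (Qinl n) f -> exists c : dhom k 0,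
  g = dcomp (Qinl 0) c /\ f = dcomp (dop (dconst 0 ord0)) c.
Proof.
move=> e; exists (dconst k ord0).
have ge : g = dcomp (Qinl 0) (dconst k ord0).
  apply: dhomP => x; apply: val_inj => /=.
  have := congr1 (fun h : dhom k (n + n.+1) => val (h x)) e.
  by rewrite [LHS]middle_val /=; have := ltn_ord (f x); lia.
split=> //; apply: Qinl_inj.
by rewrite -e ge dcompA /middle Qinl_nat -dcompA.
Qed.

Lemma middle_right n k (g : dhom k (0 + 1)) (f : dhom k n) :
  dcomp (middle n) g = dcomp (Qinr n) f -> exists c : dhom k 0,
  g = dcomp (Qinr 0) c /\ f = dcomp (dconst 0 ord0) c.
Proof.
move=> e; exists (dconst k ord0).
have ge : g = dcomp (Qinr 0) (dconst k ord0).
  apply: dhomP => x; apply: val_inj => /=.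
  have := congr1 (fun h : dhom k (n + n.+1) => val (h x)) e.
  by rewrite [LHS]middle_val /=; have := ltn_ord (g x); lia.
split=> //; apply: Qinr_inj.
by rewrite -e ge dcompA /middle Qinr_nat -dcompA.
Qed.

Lemma spine_cases n k (f : spine (n + n.+1) k) :
  [\/ exists g, sval f = dcomp (Qinl n) g, exists g, sval f = dcomp (Qinr n) g |
      exists g, sval f = dcomp (middle n) g].
Proof.
case: f => f /=; rewrite /in_spine => sf.
have lo x : f ord0 <= f x by apply: dmono.
have hi x : f x <= f ord_max by apply: dmono; rewrite /= -ltnS.
have [fl|fl] := leqP (f ord_max) n.
  have hb x : f x < n.+1 by rewrite ltnS (leq_trans (hi x)).
  have hm (x y : 'I_k.+1) : x <= y -> Ordinal (hb x) <= Ordinal (hb y).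
    by move=> xy; apply: (dmono f).
  by apply: Or31; exists (DHom hm); apply: dhomP => x; apply: val_inj.
have [fr|fr] := ltnP n (f ord0).
  have hb x : f x - n.+1 < n.+1.
    by have := lo x; have := ltn_ord (f x); lia.
  have hm (x y : 'I_k.+1) : x <= y -> Ordinal (hb x) <= Ordinal (hb y).
    by move=> xy /=; apply: leq_sub2r; apply: (dmono f).
  apply: Or32; exists (DHom hm); apply: dhomP => x; apply: val_inj => /=.
  by have := lo x; lia.
have hb x : f x - n < (0 + 1).+1.
  by have := hi x; lia.
have hm (x y : 'I_k.+1) : x <= y -> Ordinal (hb x) <= Ordinal (hb y).
  by move=> xy /=; apply: leq_sub2r; apply: (dmono f).
apply: Or33; exists (DHom hm); apply: dhomP => x; apply: val_inj.
rewrite [RHS]middle_val /=; have := lo x; have := hi x; lia.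
Qed.

(** The pullback W_1 x_(W_0 x W_0) (W_n x W_n). *)
Definition Tw_gap_target (W : sspace) n : sset :=
  spullback (Tw_proj W 0) (vertex0 (spprod (op W) W) n).

Definition Tw_gap (W : sspace) n : shom (Tw W n) (Tw_gap_target W n) :=
  spullback_pair (@vertex0_square _ _ (Tw_proj W) n).

(** The value on f of the map from the spine of [n]^op * [n] to W that a point
    of the pullback determines: its components are used on the spine of the
    first factor, on the spine of the second one and on the middle edge. *)
Definition glued (W : sspace) n l (z : Tw_gap_target W n l) k
    (f : dhom k (n + n.+1)) (x : W k l) : Prop :=
  [\/ exists g, f = dcomp (Qinl n) g /\ x = sp_act g l ((sval z).2.1 : W n l),
      exists g, f = dcomp (Qinr n) g /\ x = sp_act g l ((sval z).2.2 : W n l) |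
      exists g, f = dcomp (middle n) g /\ x = sp_act g l ((sval z).1 : W (0 + 1) l)].

(** The three parts of the spine meet only in the ends of the middle edge, where
    the equation that defines the pullback applies. *)
Lemma glued_fun (W : sspace) n l (z : Tw_gap_target W n l) k f x y :
  @glued W n l z k f x -> @glued W n l z k f y -> x = y.
Proof.
have zl : sp_act (Qinl 0) l ((sval z).1 : W (0 + 1) l) =
    sp_act (dop (dconst 0 ord0)) l ((sval z).2.1 : W n l).
  by have := congr1 fst (svalP z).
have zr : sp_act (Qinr 0) l ((sval z).1 : W (0 + 1) l) =
    sp_act (dconst 0 ord0) l ((sval z).2.2 : W n l).
  by have := congr1 snd (svalP z).
have lm g g' : dcomp (middle n) g = dcomp (Qinl n) g' ->
    sp_act g l ((sval z).1 : W (0 + 1) l) = sp_act g' l ((sval z).2.1 : W n l).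
  by move=> /middle_left[c [-> ->]]; rewrite !sp_act_comp zl.
have rm g g' : dcomp (middle n) g = dcomp (Qinr n) g' ->
    sp_act g l ((sval z).1 : W (0 + 1) l) = sp_act g' l ((sval z).2.2 : W n l).
  by move=> /middle_right[c [-> ->]]; rewrite !sp_act_comp zr.
move=> [[g [-> ->]]|[g [-> ->]]|[g [-> ->]]] [[h [e ->]]|[h [e ->]]|[h [e ->]]].
- by rewrite (Qinl_inj e).
- by case: (Qinl_neq_Qinr e).
- by rewrite (lm _ h g).
- by case: (Qinl_neq_Qinr (esym e)).
- by rewrite (Qinr_inj e).
- by rewrite (rm _ h g).
- exact: lm.
- exact: rm.
- by rewrite (middle_inj e).
Qed.

Lemma glued_act (W : sspace) n l (z : Tw_gap_target W n l) k j (b : dhom j k) f x :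
  @glued W n l z k f x -> @glued W n l z j (dcomp f b) (sp_act b l x).
Proof.
case=> -[g [-> ->]]; [apply: Or31|apply: Or32|apply: Or33];
  by exists (dcomp g b); rewrite dcompA sp_act_comp.
Qed.

Lemma glued_nat (W : sspace) n l m (c : dhom m l) (z : Tw_gap_target W n l) k f x :
  @glued W n l z k f x -> @glued W n m (act c z) k f (act c x).
Proof.
case=> -[g [-> ->]]; [apply: Or31|apply: Or32|apply: Or33];
  by exists g; rewrite -shom_nat.
Qed.

(** The map through which the Segal map of W_(2n+1) factors; its values are
    pinned down by [glued]. *)
Lemma spine_comparison (W : sspace) n :
  exists cmp : shom (Tw_gap_target W n) (Map (G (n + n.+1)) W),
    forall l z k (f : spine (n + n.+1) k),
      glued z (sval f) (row_of_Map (cmp l z) k f).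
Proof.
have ex l (z : Tw_gap_target W n l) : {h : shom (spine (n + n.+1)) (row W l) |
    forall k f, glued z (sval f) (h k f)}.
  apply: cid.
  have [||h [hz _]] := @total_lift (spine (n + n.+1)) (row W l) _ (to_point _)
    (to_point _) (fun k f x => glued z (sval f) x).
  - split=> [k j b f x|k f x y|k f x _]; last exact: point_unique.
      exact: glued_act.
    exact: glued_fun.
  - move=> k f; case: (spine_cases f) => -[g e].
    + by exists (sp_act g l ((sval z).2.1 : W n l)); apply: Or31; exists g.
    + by exists (sp_act g l ((sval z).2.2 : W n l)); apply: Or32; exists g.
    + by exists (sp_act g l ((sval z).1 : W (0 + 1) l)); apply: Or33; exists g.
  by exists h.
have cmpE l z k f : glued z (sval f) (row_of_Map (Map_of_row (sval (ex l z))) k f).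
  by rewrite /= act_id; apply: (svalP (ex l z)).
unshelve eexists.
  exists (fun l z => Map_of_row (sval (ex l z)) : Map (G (n + n.+1)) W l).
  move=> l m c z; apply: Map_ext => k f.
  rewrite (row_of_Map_act c).
  exact: glued_fun (cmpE _ _ _ _) (glued_nat c (cmpE _ _ _ _)).
exact: cmpE.
Qed.

Lemma Segal_map_at (W : sspace) n l (x : W n l) k (f : spine n k) :
  row_of_Map (Segal_map W n l x) k f = sp_act (sval f) l x.
Proof. by rewrite /= act_id. Qed.

(** For n >= 2 this is the Segal condition.  For n = 1 all simplices of Delta[1]
    belong to the spine, and the Segal map is an isomorphism. *)
Lemma Segal_map_equivalence (W : sspace) n :
  Segal_space W -> 1 <= n -> Kan_equivalence (Segal_map W n).
Proof.
move=> [_ hS] n1; have [n2|] := leqP 2 n; first exact: hS.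
move=> n2; have {n1 n2} -> : n = 1 by lia.
have s1 k (f : dhom k 1) : in_spine f.
  by rewrite /in_spine; have := ltn_ord (f ord_max); lia.
pose id1 : spine 1 1 := exist _ (did 1) (s1 _ (did 1)).
have [g gE] : exists g : shom (Map (G 1) W) (W 1), forall l m,
    g l m = row_of_Map m 1 id1.
  unshelve eexists; first exists (fun l (m : Map (G 1) W l) => row_of_Map m 1 id1).
    by move=> k l c m; exact: row_of_Map_act.
  by [].
apply: (@Kan_equivalence_of_inverses _ _ _ g (Segal_map W 1)).
  rewrite (_ : scomp _ _ = sid _); first exact: rst_refl.
  apply: shomP => l m; apply: Map_ext => k f.
  rewrite Segal_map_at gE.
  apply: etrans (esym (shom_nat (row_of_Map m) (sval f) id1)) _.
  by congr (row_of_Map m k _); apply: subsimplex_inj; rewrite /= dcomp1l.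
rewrite (_ : scomp _ _ = sid _); first exact: rst_refl.
by apply: shomP => l x; rewrite /= gE Segal_map_at sp_act_id.
Qed.

Definition left_spine n : shom (spine n) (spine (n + n.+1)).
Proof.
exists (fun k (f : spine n k) =>
  exist (@in_spine (n + n.+1) k) (dcomp (Qinl n) (sval f)) (svalP f)).
by move=> k l a f; apply: subsimplex_inj.
Defined.

Lemma spine_Qinr n k (f : dhom k n) : in_spine f -> in_spine (dcomp (Qinr n) f).
Proof. by rewrite /in_spine /= subnDl. Qed.

Definition right_spine n : shom (spine n) (spine (n + n.+1)).
Proof.
exists (fun k (f : spine n k) =>
  exist (@in_spine (n + n.+1) k) (dcomp (Qinr n) (sval f)) (spine_Qinr (svalP f))).
by move=> k l a f; apply: subsimplex_inj.
Defined.

Lemma in_spine_middle n : in_spine (middle n).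
Proof. by rewrite /in_spine !middle_val subnDl. Qed.

Definition middle_edge n : spine (n + n.+1) (0 + 1) :=
  exist _ (middle n) (in_spine_middle n).

(** The inverse restricts a map on the spine to its two outer blocks and extends
    these by a section s of the Segal map of W_n.  The deformation of W_n onto
    the image of s lies over Map(G(n), W), hence fixes vertices, so it is
    compatible with the middle edge and acts on the pullback. *)
Lemma spine_comparison_equivalence (W : sspace) n
    (cmp : shom (Tw_gap_target W n) (Map (G (n + n.+1)) W)) :
  Segal_space W -> 1 <= n ->
  (forall l z k (f : spine (n + n.+1) k),
      glued z (sval f) (row_of_Map (cmp l z) k f)) ->
  Kan_equivalence cmp.
Proof.
move=> SW n1 cmpE; have [hW _] := SW.
have [s [sE [h hE]]] := fibration_section (@Segal_map_fibration W n hW)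
  (@level_Kan_complex W n hW) (@Map_Kan_complex W (spine n) hW)
  (Segal_map_equivalence SW n1).
have sat l (y : Map (G n) W l) k (f : spine n k) :
    sp_act (sval f) l (s l y) = row_of_Map y k f.
  by rewrite -(Segal_map_at (s l y)) sE.
have hat l (x : W n l) (t : dhom l 1) k (f : spine n k) :
    sp_act (sval f) l (h l (x, t)) = sp_act (sval f) l x.
  have [_ _ e] := hE l x.
  by rewrite -(Segal_map_at (h l (x, t))) e scompE sE Segal_map_at.
pose L : shom (Map (G (n + n.+1)) W) (Map (G n) W) :=
  Map_pre W (disc_sp_map (left_spine n)).
pose R : shom (Map (G (n + n.+1)) W) (Map (G n) W) :=
  Map_pre W (disc_sp_map (right_spine n)).
(* The spine contains all vertices, in particular the two at which the outer
   blocks are attached to the middle edge. *)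
have vertexP (f : dhom 0 n) : in_spine f by rewrite /in_spine (ord1 ord_max) subnn.
pose vl : spine n 0 := exist _ (dop (dconst 0 ord0)) (vertexP _).
pose vr : spine n 0 := exist _ (dconst 0 ord0) (vertexP _).
have rowL l (m : Map (G (n + n.+1)) W l) k (f : spine n k) :
    row_of_Map (L l m) k f = row_of_Map m k (left_spine n k f) by [].
have rowR l (m : Map (G (n + n.+1)) W l) k (f : spine n k) :
    row_of_Map (R l m) k f = row_of_Map m k (right_spine n k f) by [].
pose edge l (m : Map (G (n + n.+1)) W l) : W (0 + 1) l :=
  row_of_Map m _ (middle_edge n).
have compat l (m : Map (G (n + n.+1)) W l) :
    Tw_proj W 0 l (edge l m) =
    vertex0 (spprod (op W) W) n l (s l (L l m), s l (R l m)).
  congr (_, _).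
    rewrite [RHS](sat l (L l m) 0 vl) rowL.
    rewrite [LHS](esym (shom_nat (row_of_Map m) (Qinl 0) (middle_edge n))).
    by congr (row_of_Map m _ _); apply: subsimplex_inj; rewrite /= /middle Qinl_nat.
  rewrite [RHS](sat l (R l m) 0 vr) rowR.
  rewrite [LHS](esym (shom_nat (row_of_Map m) (Qinr 0) (middle_edge n))).
  by congr (row_of_Map m _ _); apply: subsimplex_inj; rewrite /= /middle Qinr_nat.
have [back backE] : exists back : shom (Map (G (n + n.+1)) W) (Tw_gap_target W n),
    forall l m, sval (back l m) = (edge l m, (s l (L l m), s l (R l m))).
  unshelve eexists.
    exists (fun l m => exist (fun y : Tw W 0 l * spprod (op W) W n l =>
        Tw_proj W 0 l y.1 = vertex0 (spprod (op W) W) n l y.2)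
      (edge l m, (s l (L l m), s l (R l m))) (compat l m)).
    move=> j l c m; apply: spullback_inj.
      exact: (row_of_Map_act c m (middle_edge n)).
    by apply: (congr2 pair); rewrite (shom_nat L, shom_nat R) shom_nat.
  by [].
have cmpL l z k (f : spine n k) :
    row_of_Map (cmp l z) k (left_spine n k f) =
      sp_act (sval f) l ((sval z).2.1 : W n l).
  by apply: glued_fun (cmpE _ _ _ _) _; apply: Or31; exists (sval f).
have cmpR l z k (f : spine n k) :
    row_of_Map (cmp l z) k (right_spine n k f) =
      sp_act (sval f) l ((sval z).2.2 : W n l).
  by apply: glued_fun (cmpE _ _ _ _) _; apply: Or32; exists (sval f).
have cmpM l z : edge l (cmp l z) = (sval z).1.
  apply: glued_fun (cmpE _ _ _ _) _; apply: Or33; exists (did _).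
  by rewrite dcomp1r sp_act_id.
apply: (@Kan_equivalence_of_inverses _ _ _ back cmp).
  rewrite (_ : scomp _ _ = sid _); first exact: rst_refl.
  apply: shomP => l m; apply: Map_ext => k f.
  apply: glued_fun (cmpE _ _ _ _) _; rewrite /glued backE.
  have rowE j (g : dhom k j) (e : spine (n + n.+1) j) : sval f = dcomp (sval e) g ->
      row_of_Map m k f = sp_act g l (row_of_Map m j e).
    move=> fe; apply: etrans (shom_nat (row_of_Map m) g e).
    by congr (row_of_Map m k _); apply: subsimplex_inj.
  case: (spine_cases f) => -[g e]; [apply: Or31|apply: Or32|apply: Or33];
    exists g; split=> //=.
  - have sg : in_spine g by have := svalP f; rewrite e.
    rewrite (sat l (L l m) k (exist _ g sg)) rowL.
    by congr (row_of_Map m k _); apply: subsimplex_inj.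
  - have sg : in_spine g by have := svalP f; rewrite e /in_spine /= subnDl.
    rewrite (sat l (R l m) k (exist _ g sg)) rowR.
    by congr (row_of_Map m k _); apply: subsimplex_inj.
  - exact: rowE.
apply: rst_step; pose P := Tw_gap_target W n; pose I := simplex 1.
have [H1 H1E] : exists H1 : shom (sprod P I) (Tw W 0),
    forall l z t, H1 l (z, t) = (sval z).1.
  by unshelve eexists; first exists (fun l y => (sval y.1).1).
have [H2 H2E] : exists H2 : shom (sprod P I) (spprod (op W) W n), forall l z t,
    H2 l (z, t) = (h l ((sval z).2.1, t), h l ((sval z).2.2, t)).
  unshelve eexists; first exists (fun l y =>
      (h l ((sval y.1).2.1, y.2), h l ((sval y.1).2.2, y.2))).
    move=> j l c [z t]; apply: (congr2 pair).
      exact: (shom_nat h c ((sval z).2.1, t)).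
    exact: (shom_nat h c ((sval z).2.2, t)).
  by [].
have H12 l y : Tw_proj W 0 l (H1 l y) = vertex0 (spprod (op W) W) n l (H2 l y).
  case: y => z t; rewrite H1E H2E (svalP z); apply: (congr2 pair).
    by rewrite [RHS](hat l _ t 0 vl).
  by rewrite [RHS](hat l _ t 0 vr).
exists (spullback_pair H12) => l z.
have [l0 l1 _] := hE l (sval z).2.1; have [r0 r1 _] := hE l (sval z).2.2.
split; apply: spullback_inj.
- rewrite scompE backE; apply: etrans (H1E _ _ _) (esym (cmpM l z)).
- rewrite scompE backE; apply: etrans (H2E _ _ _) _; apply: (congr2 pair).
    apply: etrans l0 _; congr (s l _); apply: Map_ext => k f.
    by rewrite Segal_map_at rowL cmpL.
  apply: etrans r0 _; congr (s l _); apply: Map_ext => k f.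
  by rewrite Segal_map_at rowR cmpR.
- exact: H1E.
- by apply: etrans (H2E _ _ _) _; apply: etrans (congr2 pair l1 r1) _; case: (sval z).2.
Qed.

Theorem theorem5p3 (W : sspace) (hW : Segal_space W) :
  left_fibration (Tw_proj W).
Proof.
have [hR hS] := hW.
split=> [|n n1 B' w q qw Ew Kq]; first exact: Tw_proj_Reedy_fibration.
have Kr := Tw_proj_fibration0 hR.
have KD : Kan_complex (spprod (op W) W 0).
  exact: Kan_complex_prod (@level_Kan_complex W 0 hR) (@level_Kan_complex W 0 hR).
have KB : Kan_complex (Tw W 0) := @level_Kan_complex W (0 + 1) hR.
have KB' : Kan_complex B' := Kan_complex_total Kq KD.
have -> : spullback_pair (factor_square (@vertex0_square _ _ (Tw_proj W) n) qw) =
    scomp (base_change (vertex0 (spprod (op W) W) n) qw) (Tw_gap W n).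
  by apply: shomP => l x; apply: spullback_inj.
apply: Kan_equivalence_comp; last exact: Kan_equivalence_base_change.
have [cmp cmpE] := spine_comparison W n.
apply: (Kan_equivalence_cancel (g := cmp)).
  2: exact: spine_comparison_equivalence cmpE.
have N2 : 2 <= n + n.+1 by lia.
rewrite (_ : scomp _ _ = Segal_map W (n + n.+1)); first exact: hS N2.
apply: shomP => l x; apply: Map_ext => k f; rewrite Segal_map_at.
apply: glued_fun (cmpE _ _ _ _) _.
case: (spine_cases f) => -[g ->]; [apply: Or31|apply: Or32|apply: Or33];
  by exists g; rewrite sp_act_comp.
Qed.
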